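(* Let $T$ be a tree with $|T|\ge 3$. Then $$q(T^c)=\begin{cases}4, & \text{if } T=P_4,\\ 3, & \text{if } T\neq P_4 \text{ and either } T=S^k_{m,1} \text{ for some } k\in\{2,3\},\ m\ge 1, \text{ or } T=W(2,l,(1,d)) \text{ for some } l\ge 0,\ d\ge 1,\\ 2, & \text{otherwise.}\end{cases}$$
   Context: All graphs are finite, undirected and simple; isomorphic graphs are identified; $|G|$ is the number of vertices of $G$, and $G^c$ is the complement of $G$. For a graph $G$ with vertex set $\{1,\dots,n\}$, $S(G)$ is the set of all real symmetric $n\times n$ matrices $A=(a_{ij})$ such that for $i\ne j$, $a_{ij}\neq 0$ if and only if $\{i,j\}$ is an edge of $G$ (no restriction on the diagonal). $q(A)$ is the number of distinct eigenvalues of $A$, and $q(G)=\min\{q(A): A\in S(G)\}$. $P_n$ is the path on $n$ vertices. For $k,m,n\ge 1$, $S^k_{m,n}$ is the graph obtained from a path on $k$ vertices by attaching $m$ leaves to one terminal vertex of the path and $n$ leaves to the other terminal vertex. For $k\ge1$, $l\ge 0$ with $(k,l)\neq(1,0)$ and $\delta=(d_1,\dots,d_k)$ a $k$-tuple of positive integers, $W(k,l,\delta)$ is the tree consisting of a root vertex $0$ with $k+l$ neighbours $1,\dots,k+l$, where vertices $k+1,\dots,k+l$ are leaves, and for $1\le i\le k$ the vertex $i$ has as neighbours the root $0$ and $d_i$ further vertices which are leaves. *)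

(* Defs.v *)
From HB Require Import structures.
From mathcomp Require Import all_boot all_order all_algebra finmap.
From mathcomp Require Import all_classical all_reals.

Set Implicit Arguments.
Unset Strict Implicit.
Unset Printing Implicit Defensive.

Import Order.TTheory GRing.Theory Num.Theory.

Local Open Scope ring_scope.

Record sgraph := SGraph {
  vertex :> finType;
  edge : rel vertex;
  edge_sym : symmetric edge;
  edge_irrefl : irreflexive edge }.

Section OfRel.
Variables (V : finType) (r : rel V).

Definition sym_edge : rel V := fun x y => (x != y) && (r x y || r y x).

Lemma sym_edge_sym : symmetric sym_edge.
Proof. by move=> x y; rewrite /sym_edge eq_sym orbC. Qed.

Lemma sym_edge_irrefl : irreflexive sym_edge.
Proof. by move=> x; rewrite /sym_edge eqxx. Qed.

(* The simple graph whose edges are the {x, y} with x != y and r x y or r y x. *)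
Definition graph_of_rel : sgraph := SGraph sym_edge_sym sym_edge_irrefl.

End OfRel.

Section Complement.
Variable G : sgraph.

Definition compl_edge : rel G := fun x y => (x != y) && ~~ edge x y.

Lemma compl_edge_sym : symmetric compl_edge.
Proof. by move=> x y; rewrite /compl_edge eq_sym edge_sym. Qed.

Lemma compl_edge_irrefl : irreflexive compl_edge.
Proof. by move=> x; rewrite /compl_edge eqxx. Qed.

Definition compl : sgraph := SGraph compl_edge_sym compl_edge_irrefl.

End Complement.

Definition isomorphic (G H : sgraph) : Prop :=
  exists2 f : G -> H, bijective f & forall x y, edge (f x) (f y) = edge x y.

Definition connected (G : sgraph) : Prop :=
  forall x y : G, connect (@edge G) x y.

Definition acyclic (G : sgraph) : Prop :=
  forall c : seq G, (2 < size c)%N -> ~ ucycle (@edge G) c.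

Definition tree (G : sgraph) : Prop :=
  [/\ (0 < #|G|)%N, connected G & acyclic G].

Definition path_graph (n : nat) : sgraph :=
  graph_of_rel (fun i j : 'I_n => i.+1 == j :> nat).

(* S^k_{m,n}: the summands are the path vertices 0, ..., k-1, the m leaves at *)
(* vertex 0 and the n leaves at vertex k-1.                                   *)
Definition S_rel (k m n : nat) : rel ('I_k + ('I_m + 'I_n)) :=
  fun x y => match x, y with
  | inl i, inl j => i.+1 == j :> nat
  | inl i, inr (inl _) => i == 0%N :> nat
  | inl i, inr (inr _) => i.+1 == k :> nat
  | _, _ => false
  end.

Definition S_graph (k m n : nat) : sgraph := graph_of_rel (@S_rel k m n).

(* W(k,l,delta): None is the root, the summands are its k non-leaf neighbours, *)
(* its l leaf neighbours, and the leaves at distance 2 from the root, where    *)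
(* Tagged _ j with tag i is the j-th leaf attached to the i-th neighbour.      *)
Definition W_rel (k l : nat) (delta : k.-tuple nat) :
    rel (option ('I_k + 'I_l + {i : 'I_k & 'I_(tnth delta i)})) :=
  fun x y => match x, y with
  | None, Some (inl _) => true
  | Some (inl (inl i)), Some (inr p) => tag p == i
  | _, _ => false
  end.

Definition W_graph (k l : nat) (delta : k.-tuple nat) : sgraph :=
  graph_of_rel (@W_rel k l delta).

Arguments W_graph : clear implicits.

Section MinEigenvalues.
Variable R : realType.

(* Rows and columns are indexed by the vertices through enum_val. *)
Definition sym_matrices (G : sgraph) : set 'M[R]_#|G| :=
  [set A | A^T = A /\ forall i j : 'I_#|G|, i != j ->
             (A i j != 0) = edge (enum_val i) (enum_val j)]%classic.

Arguments sym_matrices : clear implicits.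

Definition eigenvalues (n : nat) (A : 'M[R]_n) : set R :=
  [set a | eigenvalue A a]%classic.

Lemma finite_eigenvalues (n : nat) (A : 'M[R]_n) : finite_set (eigenvalues A).
Proof.
have p_neq0 : char_poly A != 0 by rewrite monic_neq0 ?char_poly_monic.
have [s sP] : exists s : seq R, forall a, root (char_poly A) a -> a \in s.
  have [m] := ubnP (size (char_poly A)).
  elim: m (char_poly A) p_neq0 => // m IHm p p_neq0 lt_p.
  have [[a pa0]|no_root] := pselect (exists a, root p a); last first.
    by exists [::] => a pa0; case: no_root; exists a.
  have /factor_theorem[q def_p] := pa0.
  have q_neq0 : q != 0 by apply: contraNneq p_neq0 => q0; rewrite def_p q0 mul0r.
  have [|s sP] := IHm q q_neq0.
    by move: lt_p; rewrite def_p size_Mmonic ?monicXsubC // size_XsubC addn2.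
  exists (a :: s) => b; rewrite def_p rootM root_XsubC inE orbC.
  by case/orP=> [->//|/sP->]; rewrite orbT.
apply: (@sub_finite_set _ _ [set` s]); last exact: finite_seq.
by move=> a /=; rewrite /eigenvalues /= eigenvalue_root_char => /sP.
Qed.

(* fset_set is only meaningful on finite sets, see finite_eigenvalues. *)
Definition q_mx (n : nat) (A : 'M[R]_n) : nat :=
  #|` fset_set (eigenvalues A)|%fset.

Lemma sym_matrices_neq0 (G : sgraph) : exists A, sym_matrices G A.
Proof.
exists (\matrix_(i, j) (edge (enum_val i : G) (enum_val j))%:R).
split=> [|i j _]; first by apply/matrixP=> i j; rewrite !mxE edge_sym.
by rewrite mxE pnatr_eq0 eqb0 negbK.
Qed.

Lemma q_graph_subproof (G : sgraph) :
  exists k : nat, `[< exists2 A, sym_matrices G A & q_mx A = k >].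
Proof.
have [A GA] := sym_matrices_neq0 G.
by exists (q_mx A); apply/asboolP; exists A.
Qed.

Definition q_graph (G : sgraph) : nat := ex_minn (q_graph_subproof G).

End MinEigenvalues.

(* Main.v *)
Require Import Defs.
From mathcomp Require Import all_boot all_order all_algebra finmap complex.
From mathcomp Require Import all_classical all_reals.
From mathcomp Require Import ring lra.

Set Implicit Arguments.
Unset Strict Implicit.
Unset Printing Implicit Defensive.

Import Order.TTheory GRing.Theory Num.Theory.

(** Say that an edge [ab] of [T] nearly dominates if exactly one vertex [w] is
    adjacent to neither [a] nor [b]. In a tree, [w] then hangs on a neighbour [c]
    of [a] or of [b], and all vertices besides [a], [b], [c] and [w] are leaves
    at [a] or at [b]; this is why the trees with such an edge are exactly the
    exceptional ones, [P_4] included.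

    Lower bounds. Let [A] be a symmetric matrix with the zero pattern of the
    complement, so that off the diagonal [A] vanishes exactly on the edges of
    [T]. By the spectral theorem [A] is annihilated by the product of the
    [A - l] over its distinct eigenvalues [l] ([sym_annihilated]). If [ab] nearly
    dominates, the [(a, b)] entry of [(A - l) (A - m)] has the single nonzero
    term at [w], so two eigenvalues do not suffice. For the path
    [v0 v1 v2 v3] the same happens to [(A - l) (A - m) (A - n)] at [(v2, v1)].

    Upper bounds. Assign to each vertex [v] a vector [u v] of R^3 and a weight
    [c v > 0] so that [u v] and [u w] are orthogonal exactly when [vw] is an edge.
    The Gram matrix of the vectors [sqrt (c v) u v] has the zero pattern of the
    complement, and its nonzero eigenvalues are eigenvalues of the 3 x 3 matrix
    [G], the sum of the [c v] [(u v)^T (u v)] ([q_compl_le_weighted_rep]). It is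
    therefore enough that [G] has one nonzero eigenvalue in the generic case, and
    at most two for the exceptional trees other than [P_4].

    Such representations are built from small trees with integer vectors by
    adding one leaf at a time, keeping [G]. A new leaf at a vertex which already
    has a leaf can share the vector and the weight of that leaf
    ([has_weighted_rep_twin]); this settles stars, double stars and the
    exceptional trees. Otherwise, if the matrices [(u v)^T (u v)] span all
    symmetric matrices, a new leaf can be given a generic vector orthogonal to
    its parent, with a small weight whose effect on [G] is compensated by the
    old weights ([robust_rep_leaf]). The remaining trees have at least two
    vertices outside the neighbourhoods of each edge, and this forces one of
    three subtrees for which such a spanning representation is given: the path
    on 6 vertices, [W(2, 0, (2, 2))] or [W(3, 0, (1, 1, 1))]. *)

(** * Connected sets and listings of a forest *)

Section Growth.
Variable T : sgraph.
Implicit Types (S : {set T}) (x y v p : T).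

Definition induced S : rel T := [rel x y | [&& x \in S, y \in S & edge x y]].

Definition connected_set S : Prop := {in S &, forall x y, connect (induced S) x y}.

Lemma connected_set1 x : connected_set [set x].
Proof. by move=> y z; rewrite !inE => /eqP-> /eqP->; apply: connect0. Qed.

Lemma connected_setU1 S v p :
  connected_set S -> p \in S -> edge v p -> connected_set (v |: S).
Proof.
move=> conn pS vp.
have subS : subrel (connect (induced S)) (connect (induced (v |: S))).
  apply: connect_sub => x y /and3P[xS yS xy]; apply: connect1.
  by rewrite /induced /= !inE xS yS xy !orbT.
have [vp' pv'] : connect (induced (v |: S)) v p /\ connect (induced (v |: S)) p v.
  by split; apply: connect1; rewrite /induced /= !inE eqxx pS !orbT // edge_sym.
move=> x y /setU1P[->|xS] /setU1P[->|yS]; first exact: connect0.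
- exact: connect_trans vp' (subS _ _ (conn _ _ pS yS)).
- exact: connect_trans (subS _ _ (conn _ _ xS pS)) pv'.
- exact/subS/conn.
Qed.

Hypothesis acycT : acyclic T.

(** Two neighbours of [v] in a connected set avoiding [v] would close a cycle
    through [v]. All non-adjacencies below come from this fact. *)
Lemma attached_once S v x y :
    connected_set S -> v \notin S -> x \in S -> y \in S ->
  edge v x -> edge v y -> x = y.
Proof.
move=> conn vS xS yS vx vy; apply: contrapT => /eqP neq_xy.
have /connectP[p0 p0_path] := conn x y xS yS.
case/shortenP: p0_path => p p_path p_uniq _ def_y.
have pS : {subset x :: p <= S}.
  elim: p x xS p_path {p_uniq def_y neq_xy vx} => [|z p IHp] x xS /=.
    by move=> _ w; rewrite inE => /eqP->.
  move=> /andP[/and3P[_ zS _] /(IHp _ zS) pS] w; rewrite inE => /orP[/eqP->|] //.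
  exact: pS.
apply: (acycT (c := v :: x :: p)).
  by case: p {p_path p_uniq pS} def_y => //= def_y; rewrite def_y eqxx in neq_xy.
rewrite /ucycle (cons_uniq v) p_uniq andbT; apply/andP; split; last first.
  by apply: contra vS => /pS.
rewrite /= rcons_path vx -def_y edge_sym vy andbT.
by apply: sub_path p_path => a b /and3P[].
Qed.

Lemma attached_edgeE S v p :
    connected_set S -> v \notin S -> p \in S -> edge v p ->
  {in S, forall x, edge v x = (x == p)}.
Proof.
move=> conn vS pS vp x xS; apply/idP/eqP => [vx|->//].
exact: attached_once conn vS xS pS vx vp.
Qed.

Lemma connected_boundary (N : pred T) x v :
  connected T -> N x -> ~~ N v -> exists w p, [/\ ~~ N w, N p & edge w p].
Proof.
move=> connT Nx Nv; have /connectP[q] := connT x v.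
elim: q x Nx => [|y q IHq] x Nx /=; first by move=> _ def_v; rewrite def_v Nx in Nv.
move=> /andP[xy yq] def_v; have [Ny|Ny] := boolP (N y); first exact: IHq Ny yq def_v.
by exists y, x; rewrite edge_sym.
Qed.

(** The induction behind every construction: a tree arises from any
    nonempty connected part by repeatedly attaching a vertex to a single earlier one. *)
Lemma tree_growth (P : {set T} -> Prop) S :
    connected T -> S != finset.set0 -> connected_set S -> P S ->
    (forall S' v p, S \subset S' -> connected_set S' -> v \notin S' -> p \in S' ->
       edge v p -> {in S', forall x, edge v x = (x == p)} -> P S' -> P (v |: S')) ->
  P [set: T].
Proof.
move=> connT S0 connS PS step.
have grow k : (k <= #|T|) -> exists S',
    [/\ S \subset S', connected_set S' /\ P S' & (k <= #|S'|)].
  elim: k => [_|k IHk lt_k]; first by exists S.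
  have [S' [sSS' [connS' PS'] le_k]] := IHk (ltnW lt_k).
  have [/eqP eq_k|neq_k] := boolP (k == #|S'|); last first.
    by exists S'; split=> //; rewrite ltn_neqAle neq_k.
  have [x xS'] : exists x, x \in S'.
    by have /set0Pn[x /(fintype.subsetP sSS')] := S0; exists x.
  have [v vS'] : exists v, v \notin S'.
    apply: contrapT => noV; move: lt_k; rewrite eq_k ltnNge => /negP; apply.
    apply/subset_leq_card/fintype.subsetP => v _; apply: contrapT => /negP ?.
    by apply: noV; exists v.
  have [w [p [wS' pS' wp]]] := connected_boundary (N := mem S') connT xS' vS'.
  exists (w |: S'); split; last by rewrite cardsU1 wS' eq_k.
    exact: fintype.subset_trans sSS' (finset.subsetUr _ _).
  split; first exact: connected_setU1 pS' wp.
  by apply: (step _ _ p) => //; apply: attached_edgeE.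
have [S' [sS [connS' PS'] le_S']] := grow _ (leqnn _).
suff <- : S' = [set: T] by [].
by apply/eqP; rewrite eqEcard finset.subsetT cardsT.
Qed.

Section Listing.
Variable x0 : T.
Implicit Types (par : seq nat) (s : seq T).

(** [s] lists a subtree so that every vertex after the first is adjacent to an
    earlier parent, [par] giving the positions of the parents. In an acyclic
    graph these adjacencies determine all the others. *)
Definition listing par s : bool :=
  uniq s && all (fun j => (nth 0 par j < j) && edge (nth x0 s j) (nth x0 s (nth 0 par j)))
                (iota 1 (size s).-1).

Lemma listing_parent par s j : listing par s -> (0 < j < size s) ->
  (nth 0 par j < j) /\ edge (nth x0 s j) (nth x0 s (nth 0 par j)).
Proof.
move=> /andP[_ /allP par_s] /andP[j_gt0 lt_j]; apply/andP/par_s.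
by rewrite mem_iota j_gt0 add1n prednK // (leq_ltn_trans _ lt_j).
Qed.

Lemma connected_take par s k : listing par s -> (0 < k <= size s) ->
  connected_set [set x in take k s].
Proof.
move=> list_s; elim: k => // k IHk lt_k.
have [k0|k_gt0] := posnP k.
  rewrite k0 in lt_k *; case: s lt_k {list_s IHk} => // x s _ /=.
  rewrite take0 (_ : [set y in [:: x]] = [set x]); first exact: connected_set1.
  by apply/finset.setP => y; rewrite !inE.
have [lt_p kp] := listing_parent list_s (introT andP (conj k_gt0 lt_k)).
rewrite (_ : [set x in take k.+1 s] = nth x0 s k |: [set x in take k s]); last first.
  by apply/finset.setP => y; rewrite (take_nth x0) // !inE mem_rcons inE.
apply: connected_setU1 kp; first by apply: IHk; rewrite k_gt0 ltnW.
by rewrite inE -(@nth_take k) // mem_nth // size_takel // ltnW.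
Qed.

Lemma listing_connected par s :
  listing par s -> (0 < size s) -> connected_set [set x in s].
Proof. by move=> /(@connected_take _ _ (size s)); rewrite take_size leqnn andbT. Qed.

Lemma listing_edge_lt par s i j :
    listing par s -> (i < j < size s) ->
  edge (nth x0 s i) (nth x0 s j) = (nth 0 par j == i).
Proof.
move=> list_s /andP[lt_ij lt_j]; have uniq_s : uniq s by case/andP: list_s.
have j_gt0 : (0 < j) by apply: leq_trans lt_ij.
have [lt_p jp] := listing_parent list_s (introT andP (conj j_gt0 lt_j)).
have nth_in k : (k < j) -> nth x0 s k \in [set x in take j s].
  by move=> lt_k; rewrite inE -(@nth_take j) // mem_nth // size_takel // ltnW.
rewrite edge_sym (attached_edgeE _ _ (nth_in _ lt_p)) ?(nth_in _ lt_ij) //.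
- by rewrite nth_uniq ?(ltn_trans _ lt_j) // eq_sym.
- by apply: (connected_take list_s); rewrite j_gt0 ltnW.
rewrite inE; apply/negP => /(nthP x0)[k].
rewrite size_takel ?(ltnW lt_j) // => lt_k; rewrite nth_take //.
by move=> /eqP; rewrite nth_uniq ?(ltn_trans lt_k) // ltn_eqF.
Qed.

Definition par_adj par i j : bool :=
  (i < j) && (nth 0 par j == i) || (j < i) && (nth 0 par i == j).

Lemma listing_edge par s i j :
    listing par s -> (i < size s) -> (j < size s) ->
  edge (nth x0 s i) (nth x0 s j) = par_adj par i j.
Proof.
move=> list_s lt_i lt_j; rewrite /par_adj.
have [lt_ij|lt_ji|->] := ltngtP i j; last by rewrite edge_irrefl.
  by rewrite (listing_edge_lt list_s) ?lt_ij //= orbF.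
by rewrite edge_sym (listing_edge_lt list_s) ?lt_ji.
Qed.

Lemma listing_rcons_notin par s v (p : nat) :
    listing par s -> size par = size s -> (0 < size s) -> (p < size s) ->
    v \notin s -> edge v (nth x0 s p) ->
  listing (rcons par p) (rcons s v).
Proof.
move=> list_s size_par s_gt0 lt_p vs vp; have /andP[uniq_s _] := list_s.
rewrite /listing rcons_uniq vs uniq_s size_rcons /=; apply/allP => j.
rewrite mem_iota add1n !ltnS => /andP[j_gt0]; rewrite leq_eqVlt.
case/predU1P=> [->|lt_j].
  by rewrite !nth_rcons size_par ltnn eqxx lt_p.
have [lt_pj jp] := listing_parent list_s (introT andP (conj j_gt0 lt_j)).
by rewrite !nth_rcons size_par lt_j lt_pj (ltn_trans lt_pj lt_j).
Qed.

(** If [v] were already listed, it would be among the listed neighbours of its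
    parent, so only those have to be excluded. *)
Lemma listing_rcons par s v (p : nat) :
    listing par s -> size par = size s -> (p < size s) -> edge v (nth x0 s p) ->
    all (fun j => par_adj par p j ==> (v != nth x0 s j)) (iota 0 (size s)) ->
  listing (rcons par p) (rcons s v).
Proof.
move=> list_s size_par lt_p vp /allP v_new.
apply: listing_rcons_notin; rewrite ?(leq_ltn_trans _ lt_p) //.
apply/negP => /(nthP x0)[j lt_j def_v].
have := v_new j; rewrite mem_iota lt_j -(listing_edge list_s) // def_v => /(_ isT).
by rewrite edge_sym vp eqxx.
Qed.

End Listing.

End Growth.

(** * Edges that dominate all vertices but one *)

Section MissesOne.
Variable T : sgraph.
Implicit Types a b c v w x y : T.

Definition misses_one a b w : Prop :=
  [/\ edge a b, ~~ edge w a, ~~ edge w b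
    & forall v, v != w -> edge v a || edge v b].

Lemma misses_oneC a b w : misses_one a b w -> misses_one b a w.
Proof.
by case=> ab wa wb dom; split=> // [|v /dom]; rewrite 1?orbC // edge_sym.
Qed.

Definition has_near_dominating_edge : Prop := exists a b w, misses_one a b w.

Hypotheses (connT : connected T) (acycT : acyclic T).

Lemma listing2 x0 a b : edge a b -> listing x0 [:: 0; 0] [:: a; b].
Proof.
move=> ab; rewrite /listing /= inE edge_sym ab !andbT.
by apply: contraTneq ab => ->; rewrite edge_irrefl.
Qed.

(** As [T] is connected, [w] has a neighbour [c], which is adjacent to [a] or
    [b]; up to exchanging these, [w c a b] is a path. *)
Lemma near_dominating_listing :
  has_near_dominating_edge -> exists w c a b,
    listing w [:: 0; 0; 1; 2] [:: w; c; a; b] /\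
    forall v, v \notin [:: w; c; a; b] -> edge v a || edge v b.
Proof.
suff from_a a b w c : misses_one a b w -> edge w c -> edge c a ->
    exists w c a b, listing w [:: 0; 0; 1; 2] [:: w; c; a; b] /\
      forall v, v \notin [:: w; c; a; b] -> edge v a || edge v b.
  move=> [a [b [w mw]]]; have [ab wa wb dom] := mw.
  have aw : a != w by apply: contraTneq ab => ->.
  have [_ [c [/negPn/eqP-> cw wc]]] :=
    @connected_boundary T (predC1 w) a w connT aw (negbT (negbF (eqxx w))).
  by have /orP[ca|cb] := dom c cw; [exact: from_a mw wc ca
                                   |exact: from_a (misses_oneC mw) wc cb].
move=> [ab wa wb dom] wc ca; exists w, c, a, b; split; last first.
  by move=> v; rewrite inE negb_or => /andP[/dom].
have aw : a != w by apply: contraTneq ab => ->.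
have bc : b != c by apply: contraNneq wb => ->.
have l2 : listing w [:: 0; 0] [:: w; c].
  exact: listing2.
have l3 := listing_rcons acycT l2 (p := 1) erefl isT (etrans (edge_sym _ _) ca).
have {}l3 := l3 ltac:(by rewrite /= aw).
have l4 := listing_rcons acycT l3 (p := 2) erefl isT (etrans (edge_sym _ _) ab).
by apply: l4; rewrite /= bc.
Qed.

End MissesOne.

(** * Recognising the exceptional trees *)

Lemma isomorphic_inv (G H : sgraph) (g : H -> G) :
    injective g -> (forall v, exists x, g x = v) ->
    (forall x y, edge (g x) (g y) = edge x y) ->
  isomorphic G H.
Proof.
move=> g_inj g_surj g_edge; have [f fK] := choice g_surj.
exists f => [|x y]; last by rewrite -g_edge !fK.
by exists g => // x; apply: g_inj; rewrite fK.
Qed.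

Lemma isomorphic_near_dominating (G H : sgraph) :
  isomorphic G H -> has_near_dominating_edge H -> has_near_dominating_edge G.
Proof.
move=> [f [g fK gK] f_edge] [a [b [w [ab wa wb dom]]]].
exists (g a), (g b), (g w); split; rewrite -?f_edge ?gK // => v v_w.
by rewrite -!f_edge !gK dom // (can2_eq fK gK).
Qed.

Lemma S2_near_dominating m : (0 < m) -> has_near_dominating_edge (S_graph 2 m 1).
Proof.
move=> m_gt0.
exists (inl ord0), (inr (inl (Ordinal m_gt0))), (inr (inr ord0)); split=> //.
by move=> [[[|[|]] // ?]|[j|j]] //; rewrite ord1 eqxx.
Qed.

Lemma S3_near_dominating m : has_near_dominating_edge (S_graph 3 m 1).
Proof.
exists (inl ord0), (inl 1%R), (inr (inr ord0)); split=> //.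
by move=> [[[|[|[|]]] // ?]|[j|j]] //; rewrite ord1 eqxx.
Qed.

Lemma ord2_ind (P : 'I_2 -> Prop) : P ord0 -> P 1%R -> forall i, P i.
Proof.
move=> P0 P1 [[|[|//]] lt_i].
  by rewrite (_ : Ordinal lt_i = ord0) //; apply: val_inj.
by rewrite (_ : Ordinal lt_i = 1%R) //; apply: val_inj.
Qed.

Lemma W2_near_dominating l d :
  has_near_dominating_edge (W_graph 2 l [tuple 1; d]).
Proof.
pose leaves (i : 'I_2) := 'I_(tnth [tuple 1; d] i).
exists None, (Some (inl (inl 1%R))), (Some (inr (Tagged leaves (ord0 : leaves ord0)))).
split=> //.
move=> [[[[[|[|]] // ?]|j]|[i j]]|] //; elim/ord2_ind: i j => j //.
by rewrite [j]ord1 eqxx.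
Qed.

Section Coloring.
Variable T : sgraph.
Hypothesis acycT : acyclic T.
Variables (x0 : T) (par par' : seq nat) (s : seq T) (col : T -> nat).

(** When all vertices outside a listed subtree are attached to it, they are
    leaves, and adjacency depends only on the colour: the position in the
    listing, or a fresh number for each kind of leaf. This reduces the
    isomorphisms below to a comparison of colours. *)
Lemma colored_edge :
    listing x0 par s -> (0 < size s) ->
    (forall v, v \in s -> col v = index v s) ->
    (forall i, (i < size s) -> nth 0 par' i = nth 0 par i) ->
    (forall v, v \notin s -> [/\ (size s <= col v), (nth 0 par' (col v) < size s)
                    & edge v (nth x0 s (nth 0 par' (col v)))]) ->
  forall u v, edge u v = par_adj par' (col u) (col v).
Proof.
move=> list_s s_gt0 col_s par'_s col_out.
have conn := listing_connected list_s s_gt0.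
have mixed u v : u \notin s -> v \in s -> edge u v = par_adj par' (col u) (col v).
  move=> us vs; have [le_u lt_p up] := col_out u us.
  have lt_v : (index v s < size s) by rewrite index_mem.
  rewrite (attached_edgeE acycT conn _ _ up) ?inE ?mem_nth //.
  have lt_vu : (index v s < col u) := leq_trans lt_v le_u.
  rewrite /par_adj (col_s v vs) lt_vu ltnNge (ltnW lt_vu) /= eq_sym.
  rewrite -[in LHS](nth_index x0 vs).
  by rewrite nth_uniq //; case/andP: list_s.
move=> u v; have [us|us] := boolP (u \in s); have [vs|vs] := boolP (v \in s).
- rewrite -{1}(nth_index x0 us) -{1}(nth_index x0 vs).
  rewrite (listing_edge acycT list_s) ?index_mem // -!col_s // /par_adj.
  by rewrite !par'_s ?col_s ?index_mem.
- by rewrite edge_sym mixed // /par_adj orbC.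
- exact: mixed.
have [le_u lt_pu up] := col_out u us; have [le_v lt_pv vp] := col_out v vs.
have -> : par_adj par' (col u) (col v) = false.
  rewrite /par_adj !ltn_eqF ?(leq_trans lt_pu) ?(leq_trans lt_pv) //.
  by rewrite !andbF.
have [->|u_v] := eqVneq u v; first by rewrite edge_irrefl.
apply/negP => uv; move: vs.
pose pu := nth x0 s (nth 0 par' (col u)).
rewrite (@attached_once _ acycT (v |: [set x in s]) u v pu) //.
- by rewrite mem_nth.
- by apply: connected_setU1 vp; rewrite // inE mem_nth.
- by rewrite !inE negb_or u_v.
- by rewrite !inE eqxx.
- by rewrite !inE mem_nth // orbT.
Qed.
End Coloring.

Section Recognition.
Variable T : sgraph.
Hypothesis acycT : acyclic T.
Implicit Types a b c v w : T.

Lemma path4_listing w c a b :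
    listing w [:: 0; 0; 1; 2] [:: w; c; a; b] ->
    (forall v, v \in [:: w; c; a; b]) ->
  isomorphic T (path_graph 4).
Proof.
move=> list_s all_s; set s := [:: w; c; a; b] in list_s all_s.
apply: (@isomorphic_inv _ (path_graph 4) (fun i : 'I_4 => nth w s i)).
- move=> i j /eqP; have /andP[uniq_s _] := list_s.
  by rewrite nth_uniq ?(ltn_ord i) ?(ltn_ord j) // => /eqP/val_inj.
- by move=> v; have /(nthP w)[i lt_i <-] := all_s v; exists (Ordinal lt_i).
move=> i j; rewrite (listing_edge acycT list_s) ?(ltn_ord i) ?(ltn_ord j) //.
by move: i j => [[|[|[|[|]]]] // ?] [[|[|[|[|]]]] // ?].
Qed.

(** The vertices outside [w c a] are the leaves of [a]. In the application the
    end [b] of the near-dominating edge is one of them. *)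
Lemma isomorphic_S2 w c a :
    listing w [:: 0; 0; 1] [:: w; c; a] ->
    (forall v, v \notin [:: w; c; a] -> edge v a) ->
  isomorphic T (S_graph 2 #|[set v | v \notin [:: w; c; a]]| 1).
Proof.
move=> list_s out_a; set s := [:: w; c; a]; set M := [set v | _].
have /andP[uniq_s _] := list_s.
pose col v := if v \in s then index v s else 3.
have col_edge : forall u v, edge u v = par_adj [:: 0; 0; 1; 2] (col u) (col v).
  apply: (colored_edge acycT list_s) => // [v vs|[|[|[|?]]] //|v vs].
    by rewrite /col vs.
  by rewrite /col (negPf vs); split=> //; apply: out_a.
pose g (x : S_graph 2 #|M| 1) : T := match x with
  | inl i => if i == ord0 then a else c
  | inr (inl j) => enum_val j
  | inr (inr _) => w
  end.
have colM j : col (enum_val (A := M) j) = 3.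
  by have := enum_valP j; rewrite inE /col => /negPf->.
have cola : col a = 2 by rewrite /col !inE eqxx !orbT (index_uniq w (i := 2) _ uniq_s).
have colc : col c = 1 by rewrite /col !inE eqxx !orbT (index_uniq w (i := 1) _ uniq_s).
have colw : col w = 0 by rewrite /col !inE eqxx (index_uniq w (i := 0) _ uniq_s).
apply: (@isomorphic_inv T (S_graph 2 #|M| 1) g).
- move=> x y e; have := congr1 col e; move: e.
  case: x => [i|[i|i]]; case: y => [j|[j|j]]; rewrite /= ?colM ?colw //.
  + by elim/ord2_ind: i; elim/ord2_ind: j; rewrite /= ?cola ?colc.
  + by elim/ord2_ind: i; rewrite /= ?cola ?colc.
  + by elim/ord2_ind: i; rewrite /= ?cola ?colc.
  + by elim/ord2_ind: j; rewrite /= ?cola ?colc.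
  + by move=> /enum_val_inj->.
  + by elim/ord2_ind: j; rewrite /= ?cola ?colc.
  + by rewrite (ord1 i) (ord1 j).
- move=> v; have [vs|vs] := boolP (v \in s).
    move: vs; rewrite !inE => /or3P[]/eqP->.
    + by exists (inr (inr ord0)).
    + by exists (inl 1%R).
    + by exists (inl ord0).
  have vM : v \in M by rewrite inE.
  by exists (inr (inl (enum_rank_in vM v))); rewrite /= enum_rankK_in.
move=> x y; rewrite col_edge.
case: x => [i|[i|i]]; case: y => [j|[j|j]]; rewrite /= ?colM ?colw /sym_edge ?andbF //.
- by elim/ord2_ind: i; elim/ord2_ind: j; rewrite /= ?cola ?colc.
- by elim/ord2_ind: i; rewrite /= ?cola ?colc.
- by elim/ord2_ind: i; rewrite /= ?cola ?colc.
- by elim/ord2_ind: j; rewrite /= ?cola ?colc.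
- by elim/ord2_ind: j; rewrite /= ?cola ?colc.
Qed.

(** The root is [a]; [c] carries the single leaf [w], and [b] all leaves that are
    not attached to [a]. *)
Lemma isomorphic_W2 w c a b :
    listing w [:: 0; 0; 1; 2] [:: w; c; a; b] ->
    (forall v, v \notin [:: w; c; a; b] -> edge v a || edge v b) ->
  isomorphic T (W_graph 2 #|[set v | v \notin [:: w; c; a; b] & edge v a]|
                 [tuple 1; #|[set v | v \notin [:: w; c; a; b] & edge v b]|]).
Proof.
move=> list_s dom; set s := [:: w; c; a; b].
set L := [set v | _ & edge v a]; set D := [set v | _ & edge v b].
have /andP[uniq_s _] := list_s.
pose col v := if v \in s then index v s else if edge v a then 4 else 5.
have conn := listing_connected list_s isT.
have a_b : a != b by move: uniq_s; rewrite /= !inE; case/and4P.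
have not_both v : v \notin s -> edge v a -> edge v b -> False.
  move=> vs va vb; move/eqP: a_b; apply.
  by apply: (attached_once acycT conn _ _ _ va vb); rewrite inE // !inE eqxx ?orbT.
have col_edge : forall u v, edge u v = par_adj [:: 0; 0; 1; 2; 2; 3] (col u) (col v).
  apply: (colored_edge acycT list_s) => // [v vs|[|[|[|[|?]]]] //|v vs].
    by rewrite /col vs.
  rewrite /col (negPf vs); case: ifP (dom v vs) => // va vb; split=> //.
pose W := W_graph 2 #|L| [tuple 1; #|D|].
pose g (x : W) : T := match x with
  | None => a
  | Some (inl (inl i)) => if i == ord0 then c else b
  | Some (inl (inr j)) => enum_val j
  | Some (inr p) => if tag p == ord0 then w else nth w (enum D) (tagged p)
  end.
have colL j : col (enum_val (A := L) j) = 4.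
  by have := enum_valP j; rewrite inE /col => /andP[/negPf-> ->].
have colD j : (j < #|D|) -> col (nth w (enum D) j) = 5.
  move=> lt_j; have : nth w (enum D) j \in D by rewrite -mem_enum mem_nth // -cardE.
  rewrite inE /col => /andP[vs vb]; rewrite (negPf vs).
  by case: ifP => // va; case: (not_both _ vs va vb).
have colw : col w = 0 by rewrite /col !inE eqxx (index_uniq w (i := 0) _ uniq_s).
have colc : col c = 1 by rewrite /col !inE eqxx !orbT (index_uniq w (i := 1) _ uniq_s).
have cola : col a = 2 by rewrite /col !inE eqxx !orbT (index_uniq w (i := 2) _ uniq_s).
have colb : col b = 3 by rewrite /col !inE eqxx !orbT (index_uniq w (i := 3) _ uniq_s).
pose colW (x : W) : nat := match x with
  | None => 2
  | Some (inl (inl i)) => if i == ord0 then 1 else 3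
  | Some (inl (inr j)) => 4
  | Some (inr p) => if tag p == ord0 then 0 else 5
  end.
have col_g x : col (g x) = colW x.
  case: x => [[[i|j]|[i j]]|] //=; first by case: ifP.
  by elim/ord2_ind: i j => //= j; apply: colD.
apply: (@isomorphic_inv T W g).
- move=> x y e; have := congr1 col e; rewrite !col_g; move: e.
  case: x => [[[i|i]|[i i']]|]; case: y => [[[j|j]|[j j']]|] //=;
    do ?[elim/ord2_ind: i | elim/ord2_ind: i i' => i']; 
    do ?[elim/ord2_ind: j | elim/ord2_ind: j j' => j'] => //=.
  + by move=> /enum_val_inj->.
  + by rewrite (ord1 i') (ord1 j').
  + move=> /eqP; rewrite nth_uniq ?enum_uniq -?cardE ?(ltn_ord i') ?(ltn_ord j') //.
    by move=> /eqP/val_inj->.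
- move=> v; have [vs|vs] := boolP (v \in s).
    move: vs; rewrite !inE => /or4P[]/eqP->.
    + by exists (Some (inr (Tagged (fun i => 'I_(tnth [tuple 1; #|D|] i))
                             (ord0 : 'I_(tnth [tuple 1; #|D|] ord0))))).
    + by exists (Some (inl (inl ord0))).
    + by exists None.
    + by exists (Some (inl (inl 1%R))).
  case/orP: (dom v vs) => [va|vb].
    have vL : v \in L by rewrite inE vs.
    by exists (Some (inl (inr (enum_rank_in vL v)))); rewrite /= enum_rankK_in.
  have vD : v \in D by rewrite inE vs.
  have lt_v : (index v (enum D) < tnth [tuple 1; #|D|] 1%R).
    by rewrite (tnth_nth 0) /= cardE index_mem mem_enum.
  exists (Some (inr (Tagged (fun i => 'I_(tnth [tuple 1; #|D|] i)) (Ordinal lt_v)))).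
  by rewrite /= nth_index // mem_enum.
move=> x y; rewrite col_edge !col_g.
case: x => [[[i|i]|[i i']]|]; case: y => [[[j|j]|[j j']]|] //=;
  rewrite /sym_edge /= ?andbF //;
    do ?[elim/ord2_ind: i | elim/ord2_ind: i i' => i'];
    do ?[elim/ord2_ind: j | elim/ord2_ind: j j' => j'] => //=.
Qed.

End Recognition.

Definition exceptional_tree (T : sgraph) : Prop :=
  (exists k m : nat, [/\ (k = 2 \/ k = 3), 1 <= m & isomorphic T (S_graph k m 1)])
  \/ (exists l d : nat, 1 <= d /\ isomorphic T (W_graph 2 l [tuple 1; d])).

Lemma path4_order (T : sgraph) :
  isomorphic T (path_graph 4) ->
  #|T| = 4 /\ exists v0 v1 v2 v3 : T,
    [/\ uniq [:: v0; v1; v2; v3], forall v, v \in [:: v0; v1; v2; v3],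
        [/\ edge v0 v1, edge v1 v2 & edge v2 v3]
      & [/\ ~~ edge v0 v2, ~~ edge v0 v3 & ~~ edge v1 v3]].
Proof.
move=> [f [g fK gK] f_edge]; split.
  by rewrite (bij_eq_card (Bijective fK gK)) card_ord.
pose h k : T := g (inord k : 'I_4); exists (h 0), (h 1), (h 2), (h 3).
have h_inj : {in [pred k | k < 4] &, injective h}.
  by move=> i j lt_i lt_j /(can_inj gK)/(congr1 val) /=; rewrite !inordK.
split.
- rewrite -[[:: _; _; _; _]]/(map h (iota 0 4)) map_inj_in_uniq ?iota_uniq //.
  by move=> i j; rewrite !mem_iota => lt_i lt_j; apply: h_inj.
- move=> v; rewrite -[[:: _; _; _; _]]/(map h (iota 0 4)); apply/mapP.
  exists (val (f v)); first by rewrite mem_iota ltn_ord.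
  by rewrite /h inord_val fK.
- by rewrite -!f_edge !gK /= /sym_edge -!val_eqE /= !inordK.
- by rewrite -!f_edge !gK /= /sym_edge -!val_eqE /= !inordK.
Qed.

Lemma near_dominating_exceptional (T : sgraph) :
    connected T -> acyclic T -> has_near_dominating_edge T ->
  exceptional_tree T.
Proof.
move=> connT acycT /(near_dominating_listing connT acycT)[w [c [a [b [list4 dom]]]]].
have [D0|[v vD]] := set_0Vmem [set v | v \notin [:: w; c; a; b] & edge v b]; last first.
  right; exists #|[set v | v \notin [:: w; c; a; b] & edge v a]|.
  exists #|[set v | v \notin [:: w; c; a; b] & edge v b]|; split.
    by apply/card_gt0P; exists v.
  exact: isomorphic_W2 list4 dom.
left; exists 2, #|[set v | v \notin [:: w; c; a]]|.
have /andP[uniq4 /and4P[e1 e2 e3 _]] := list4.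
have b3 : b \notin [:: w; c; a].
  by move: uniq4; rewrite -[[:: w; c; a; b]]/(rcons [:: w; c; a] b) rcons_uniq => /andP[].
split; first by left.
  by apply/card_gt0P; exists b; rewrite inE.
apply: isomorphic_S2 => // [|v v3].
  by apply/andP; split; [apply: (take_uniq 3 uniq4) | apply/and3P].
have [->|v_b] := eqVneq v b; first by case/andP: e3.
have v4 : v \notin [:: w; c; a; b].
  by move: v3; rewrite !inE !negb_or v_b => /and3P[-> -> ->].
case/orP: (dom v v4) => // vb.
have : v \in [set v | v \notin [:: w; c; a; b] & edge v b] by rewrite inE v4.
by rewrite D0 inE.
Qed.

Lemma exceptional_near_dominating (T : sgraph) :
  exceptional_tree T -> has_near_dominating_edge T.
Proof.
case=> [[k [m [[]-> m_gt0 isoT]]]|[l [d [_ isoT]]]];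
  apply: isomorphic_near_dominating isoT _.
- exact: S2_near_dominating.
- exact: S3_near_dominating.
- exact: W2_near_dominating.
Qed.

Lemma nonadjacent_pair (T : sgraph) :
  acyclic T -> (2 < #|T|) -> exists x y : T, x != y /\ ~~ edge x y.
Proof.
move=> acycT /card_gt2P[x [y [z [_ [xy yz zx]]]]].
apply: contrapT => complete.
have adj (u v : T) : u != v -> edge u v.
  by move=> u_v; apply: contrapT => /negP uv; apply: complete; exists u, v.
apply: (acycT [:: x; y; z]) => //.
rewrite /ucycle /= !adj //= !inE negb_or xy yz eq_sym zx.
by [].
Qed.

Local Open Scope ring_scope.

(** * Spectra of symmetric matrices *)

Lemma mul_conj_diag (F : fieldType) (n : nat) (P : 'M[F]_n) (d e : 'rV[F]_n) (a : F) :
    P \in unitmx ->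
  (invmx P *m diag_mx d *m P - a%:M) *m (invmx P *m diag_mx e *m P) =
  invmx P *m diag_mx (\row_i ((d 0 i - a) * e 0 i)) *m P.
Proof.
move=> PU; have -> : a%:M = invmx P *m a%:M *m P.
  by rewrite mul_mx_scalar -scalemxAl mulVmx // scalemx1.
rewrite -mulmxBl -mulmxBr !mulmxA mulmxK //; congr (_ *m _).
rewrite -!mulmxA; congr (_ *m _); rewrite -diag_const_mx -raddfB mulmx_diag.
by congr diag_mx; apply/rowP=> i; rewrite !mxE.
Qed.

Section Spectrum.
Variable R : realType.

(** Over the complex numbers a real symmetric matrix is unitarily diagonalised,
    with real eigenvalues, so each diagonal entry is killed by one factor. *)
Lemma sym_annihilated (n : nat) (A : 'M[R]_n) (s : seq R) :
    A^T = A -> (forall a, eigenvalue A a -> a \in s) ->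
  foldr (fun a B => (A - a%:M) *m B) 1%:M s = 0.
Proof.
move=> symA eigA; pose C := R[i]; pose iota := real_complex R : R -> C.
pose AC := map_mx iota A.
have hermAC : AC \is hermsymmx.
  apply: realsym_hermsym.
    by apply/is_hermitianmxP; rewrite expr0 scale1r map_mx_id // map_trmx symA.
  by apply/mxOverP => i j; rewrite mxE complex_real.
have [P [e [PU defAC]]] : exists (P : 'M[C]_n) (e : 'I_n -> R), P \in unitmx /\
    AC = invmx P *m diag_mx (\row_i iota (e i)) *m P.
  have /mxOverP real_d := hermitian_spectral_diag_real hermAC.
  exists (spectralmx AC), (fun i => complex.Re (spectral_diag AC 0 i)).
  split; first exact: spectral_unit.
  have def_d : spectral_diag AC = \row_i iota (complex.Re (spectral_diag AC 0 i)).
    by apply/rowP=> i; rewrite mxE /iota RRe_real ?real_d.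
  by rewrite -def_d; apply/orthomx_spectralP; apply: hermitian_normalmx.
set d := \row_i _ in defAC; have def_d i : d 0 i = iota (e i) by rewrite mxE.
have e_s i : e i \in s.
  apply: eigA; suff: eigenvalue AC (d 0 i) by rewrite def_d eigenvalue_map.
  apply/eigenvalueP; exists (row i P); last first.
    apply/eqP=> /(congr1 (mulmx^~ (invmx P))); rewrite rowE mulmxK // mul0mx.
    by move=> /rowP/(_ i)/eqP; rewrite !mxE !eqxx oner_eq0.
  rewrite {1}defAC !rowE -!mulmxA mulKVmx // mulmxA -(rowE i (diag_mx d)).
  by rewrite row_diag_mx -scalemxAl.
have prodE (t : seq R) :
    map_mx iota (foldr (fun a B => (A - a%:M) *m B) 1%:M t)
    = invmx P *m diag_mx (\row_i \prod_(a <- t) (d 0 i - iota a)) *m P.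
  elim: t => [|a t IHt] /=.
    rewrite map_mx1 (_ : diag_mx _ = 1%:M) ?mulmx1 ?mulVmx //.
    by apply/matrixP=> i j; rewrite !mxE big_nil.
  have -> : \row_i \prod_(b <- a :: t) (d 0 i - iota b) =
      \row_i ((d 0 i - iota a) * (\row_k \prod_(b <- t) (d 0 k - iota b)) 0 i).
    by apply/rowP=> i; rewrite !mxE big_cons.
  rewrite map_mxM IHt map_mxB map_scalar_mx -/AC {1}defAC.
  exact: (@mul_conj_diag C n P d _ (iota a) PU).
apply: (@map_mx_inj _ _ iota); rewrite prodE map_mx0.
rewrite (_ : diag_mx _ = 0) ?mulmx0 ?mul0mx //.
apply/matrixP=> i j; rewrite !mxE (big_rem (e i)) //= subrr mul0r.
by rewrite mul0rn.
Qed.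

Lemma q_mx_le_spectrum (n : nat) (A : 'M[R]_n) (s : seq R) :
  (forall a, eigenvalue A a -> a \in s) -> (q_mx A <= size s)%N.
Proof.
move=> eigA; apply: leq_trans (size_undup s).
rewrite -card_fseq /q_mx; apply/fsubset_leq_card/fsubsetP => a.
rewrite in_fset_set; last exact: finite_eigenvalues.
rewrite inE /= => /eigA as_.
by rewrite in_imfset.
Qed.

Lemma spectrum_le_q_mx (n k : nat) (A : 'M[R]_n) :
    (q_mx A <= k)%N ->
  exists2 s : seq R, size s = k & forall a, eigenvalue A a -> a \in s.
Proof.
move=> le_k; pose s := enum_fset (fset_set (eigenvalues A)).
exists (s ++ nseq (k - size s) 0); first by rewrite size_cat size_nseq subnKC.
move=> a eig_a; rewrite mem_cat; apply/orP; left.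
rewrite -[a \in s]/(a \in fset_set (eigenvalues A)) in_fset_set ?inE //.
exact: finite_eigenvalues.
Qed.

End Spectrum.

Section MinEigenvalueCount.
Variables (R : realType) (G : sgraph).

Lemma q_graph_le (A : 'M[R]_#|G|) :
  @sym_matrices R G A -> (q_graph R G <= q_mx A)%N.
Proof.
move=> GA; rewrite /q_graph; case: ex_minnP => k _; apply.
by apply/asboolP; exists A.
Qed.

Lemma q_graph_ge (k : nat) :
    (forall A : 'M[R]_#|G|, @sym_matrices R G A -> (k <= q_mx A)%N) ->
  (k <= q_graph R G)%N.
Proof.
move=> leA; rewrite /q_graph; case: ex_minnP => m /asboolP[A GA <-] _.
exact: leA.
Qed.

Lemma q_graph_le_card : (q_graph R G <= #|G|)%N.
Proof.
have [A GA] := sym_matrices_neq0 R G; apply: leq_trans (q_graph_le GA) _.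
have fin := finite_eigenvalues A.
have p0 : char_poly A != 0 by rewrite monic_neq0 ?char_poly_monic.
have := @max_poly_roots _ _ (enum_fset (fset_set (eigenvalues A))) p0 _ (fset_uniq _).
rewrite size_char_poly ltnS; apply; apply/allP => a.
rewrite -[a \in enum_fset _]/(a \in fset_set (eigenvalues A)).
by rewrite in_fset_set // inE /= /eigenvalues /= eigenvalue_root_char.
Qed.

End MinEigenvalueCount.

(** * Matrices of T^c from weighted orthogonal representations *)

Section Frame.
Variable R : realType.
Implicit Types u v : 'rV[R]_3.

Definition dot u v : R := (u *m v^T) 0 0.

Lemma dotE u v : dot u v = \sum_k u 0 k * v 0 k.
Proof. by rewrite /dot mxE; apply: eq_bigr => k _; rewrite mxE. Qed.

Definition frame_op (T : finType) (S : {set T}) (c : T -> R) (u : T -> 'rV[R]_3) :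
    'M[R]_3 :=
  \sum_(v in S) c v *: ((u v)^T *m u v).

Definition orthogonal_rep (T : sgraph) (S : {set T}) (u : T -> 'rV[R]_3) : Prop :=
  {in S &, forall x y, (dot (u x) (u y) == 0) = edge x y}.

Definition has_weighted_rep (T : sgraph) (S : {set T}) (G : 'M[R]_3) : Prop :=
  exists (c : T -> R) (u : T -> 'rV[R]_3),
    [/\ {in S, forall x, 0 < c x}, orthogonal_rep S u
                & frame_op S c u = G].

(** With [U] the matrix of the vectors [sqrt (c v) u v], the matrix [U^T U] has
    the required zero pattern and [U U^T = G]; if [x] is an eigenvector of
    [U^T U] for [a != 0], then [x U^T] is one of [G] for [a]. *)
Lemma q_compl_le_weighted_rep (T : sgraph) (G : 'M[R]_3) (s : seq R) :
    has_weighted_rep [set: T] G ->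
    (forall a, a != 0 -> eigenvalue G a -> a \in s) ->
  (q_graph R (compl T) <= (size s).+1)%N.
Proof.
move=> [c [u [c_gt0 orth_u <-]]] eigG.
pose U : 'M[R]_(3, #|T|) :=
  \matrix_(k, i) (Num.sqrt (c (enum_val i)) * u (enum_val i) 0 k).
pose A : 'M[R]_#|compl T| := U^T *m U.
have defG : frame_op [set: T] c u = U *m U^T.
  apply/matrixP=> k l; rewrite /frame_op !summxE mxE.
  under eq_bigl do rewrite inE.
  rewrite (big_enum_val (A := T)) /=; apply: eq_bigr => i _.
  rewrite !mxE big_ord1 !mxE mulrACA -expr2 sqr_sqrtr //.
  by rewrite ltW // c_gt0 ?inE.
have A_E i j : A i j = Num.sqrt (c (enum_val i)) * Num.sqrt (c (enum_val j))
                       * dot (u (enum_val i)) (u (enum_val j)).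
  rewrite mxE dotE mulr_sumr; apply: eq_bigr => k _.
  by rewrite !mxE mulrACA.
have symA : @sym_matrices R (compl T) A.
  split=> [|i j neq_ij]; first by rewrite /A trmx_mul trmxK.
  rewrite A_E !mulf_eq0 !sqrtr_eq0 !leNgt !c_gt0 ?inE //= orth_u ?inE //.
  by rewrite /compl_edge (inj_eq enum_val_inj) neq_ij.
apply: leq_trans (q_graph_le symA) _.
apply: (@q_mx_le_spectrum _ _ _ (0 :: s)) => a /eigenvalueP[v vA v_neq0].
rewrite inE; have [//|a_neq0 /=] := eqVneq a 0.
apply: eigG => //; rewrite defG; apply/eigenvalueP; exists (v *m U^T).
  by rewrite mulmxA -[v *m U^T *m U]mulmxA vA scalemxAl.
apply: contraNneq v_neq0 => w0.
have := vA; rewrite /A mulmxA w0 mul0mx => /esym/eqP.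
by rewrite scaler_eq0 (negPf a_neq0).
Qed.

Lemma eigenvalue_diag (n : nat) (d : 'rV[R]_n) (a : R) :
  eigenvalue (diag_mx d) a -> exists k, a = d 0 k.
Proof.
move=> /eigenvalueP[v vd v_neq0]; have /rV0Pn[k vk] := v_neq0.
exists k; move/rowP/(_ k): vd; rewrite mul_mx_diag !mxE mulrC.
by move/(mulIf vk).
Qed.

End Frame.

(** * Adding a leaf to a representation *)

Section Vectors.
Variable R : realType.
Implicit Types a b x y : 'rV[R]_3.

Lemma mem_ord3 (k : 'I_3) : k \in [:: 0; 1; 2].
Proof. by case: k => [[|[|[|]]]]. Qed.

Lemma row3P x y :
  x 0 0 = y 0 0 -> x 0 1 = y 0 1 -> x 0 2 = y 0 2 -> x = y.
Proof.
by move=> e0 e1 e2; apply/rowP => k; have := mem_ord3 k; rewrite !inE => /or3P[]/eqP->.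
Qed.

Lemma sum3E (F : 'I_3 -> R) : \sum_k F k = F 0 + F 1 + F 2.
Proof.
rewrite !big_ord_recl big_ord0 addr0 addrA.
by congr (F _ + F _ + F _); apply/val_inj.
Qed.

Lemma dot3E x y : dot x y = x 0 0 * y 0 0 + x 0 1 * y 0 1 + x 0 2 * y 0 2.
Proof. by rewrite dotE sum3E. Qed.

Lemma dotC x y : dot x y = dot y x.
Proof. by rewrite !dot3E; ring. Qed.

Lemma dot_eq0 x : (dot x x == 0) = (x == 0).
Proof.
apply/eqP/eqP => [|->]; last by rewrite /dot mul0mx mxE.
rewrite dot3E -!expr2 => /eqP; rewrite paddr_eq0 ?addr_ge0 ?sqr_ge0 //.
rewrite paddr_eq0 ?sqr_ge0 // !sqrf_eq0 => /andP[/andP[/eqP x0 /eqP x1] /eqP x2].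
by apply: row3P; rewrite !mxE.
Qed.

Definition cross x y : 'rV[R]_3 :=
  \row_k [:: x 0 1 * y 0 2 - x 0 2 * y 0 1; x 0 2 * y 0 0 - x 0 0 * y 0 2;
             x 0 0 * y 0 1 - x 0 1 * y 0 0]`_k.

Lemma dot_crossl a y b : dot (cross a y) b = dot y (cross b a).
Proof. by rewrite !dot3E !mxE /=; ring. Qed.

Lemma cross_crossl a y b : cross (cross a y) b = dot a b *: y - dot y b *: a.
Proof. by apply: row3P; rewrite !mxE !dot3E /=; ring. Qed.

Lemma crossxx a : cross a a = 0.
Proof. by apply: row3P; rewrite !mxE /=; ring. Qed.

Lemma crossZr a y k : cross a (k *: y) = k *: cross a y.
Proof. by apply: row3P; rewrite !mxE /=; ring. Qed.

Lemma cross_eq0C a y : (cross a y == 0) = (cross y a == 0).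
Proof.
suff imp b z : cross b z = 0 -> cross z b = 0 by apply/eqP/eqP; apply: imp.
move=> bz; rewrite -oppr0 -bz; apply: row3P; rewrite !mxE /=; ring.
Qed.

Lemma poly_neq0_nonroot (p : {poly R}) : p != 0 -> exists t, p.[t] != 0.
Proof.
move=> p0; apply: contrapT => noroot.
have := @max_poly_roots _ p [seq i%:R | i <- iota 0 (size p)] p0.
rewrite size_map size_iota ltnn; case/(_ _ _)/notF.
  by apply/allP => a _; apply/negPn/negP => pa; apply: noroot; exists a.
by rewrite map_inj_uniq ?iota_uniq // => i j /eqP; rewrite eqr_nat => /eqP.
Qed.

(** A point of the moment curve [(1, t, t^2)] lies on the plane orthogonal to
    [n != 0] only for the finitely many roots [t] of a quadratic polynomial. *)
Lemma generic_vector (s : seq 'rV[R]_3) :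
  exists y, {in s, forall n, n != 0 -> dot y n != 0}.
Proof.
pose poly_of (n : 'rV[R]_3) : {poly R} := Poly [:: n 0 0; n 0 1; n 0 2].
have horner_poly n t : (poly_of n).[t] = n 0 0 + n 0 1 * t + n 0 2 * t ^+ 2.
  by rewrite horner_Poly /=; ring.
have poly_neq0 n : n != 0 -> poly_of n != 0.
  apply: contra_neq => /(congr1 (fun p : {poly R} => [:: p`_0; p`_1; p`_2])).
  by rewrite !coef_Poly !coef0 /= => -[n0 n1 n2]; apply: row3P; rewrite !mxE.
have : \prod_(n <- s | n != 0) poly_of n != 0.
  by rewrite prodf_seq_neq0; apply/allP => n _; apply/implyP/poly_neq0.
move=> /poly_neq0_nonroot[t]; rewrite horner_prod prodf_seq_neq0 => /allP nz_t.
exists (\row_k [:: 1; t; t ^+ 2]`_k) => n /nz_t /implyP nz /nz.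
by rewrite horner_poly dot3E !mxE /= mul1r [t * _]mulrC [t ^+ 2 * _]mulrC.
Qed.

(** Take for [x] the cross product of [a] with a generic [y]: orthogonality of
    [x] to a [b] not collinear with [a], and collinearity of [x] with a nonzero
    [b], each imply a nontrivial linear condition on [y]. *)
Lemma generic_orthogonal a (s : seq 'rV[R]_3) :
    a != 0 -> {in s, forall b, b != 0} ->
  exists x, [/\ x != 0, dot x a = 0,
    {in s, forall b, cross x b != 0}
  & {in s, forall b, cross b a != 0 -> dot x b != 0}].
Proof.
move=> a0 s0; pose e k : 'rV[R]_3 := delta_mx 0 k.
have [k ek] : exists k, cross (e k) a != 0.
  apply: contrapT => no_k; move/eqP: a0; apply.
  have e0 k : cross (e k) a = 0 by apply/eqP/negPn/negP => ?; apply: no_k; exists k.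
  have /rowP/(_ 2) := e0 0; have /rowP/(_ 1) := e0 0; have /rowP/(_ 2) := e0 1.
  rewrite !mxE /= => h0 h2 h1; apply: row3P; rewrite mxE; lra.
have [y y_gen] := generic_vector (cross (e k) a :: s ++ [seq cross b a | b <- s]).
have x0 : cross a y != 0.
  have := y_gen _ (mem_head _ _) ek; apply: contra_neq => ay0.
  by rewrite -dot_crossl ay0 /dot mul0mx mxE.
exists (cross a y); split=> // [|b bs|b bs ba].
- by rewrite dot_crossl crossxx /dot trmx0 mulmx0 mxE.
- rewrite cross_crossl; have [ab|ab] := eqVneq (dot a b) 0.
    rewrite ab scale0r sub0r oppr_eq0 scaler_eq0 (negPf a0) orbF.
    by apply: y_gen; [rewrite inE mem_cat bs orbT | exact: s0].
  apply: contra_neq x0 => /eqP; rewrite subr_eq0 => /eqP ab_y.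
  apply/eqP; have /eqP := congr1 (cross a) ab_y.
  by rewrite !crossZr crossxx scaler0 scaler_eq0 (negPf ab).
- rewrite dot_crossl; apply: y_gen => //.
  by rewrite inE mem_cat (map_f (fun b => cross b a) bs) !orbT.
Qed.

End Vectors.

Section Extension.
Variables (R : realType) (T : sgraph).
Implicit Types (S : {set T}) (G : 'M[R]_3).

Lemma frame_opU1 S (v : T) (c : T -> R) (u : T -> 'rV[R]_3) :
  v \notin S -> frame_op (v |: S) c u = c v *: ((u v)^T *m u v) + frame_op S c u.
Proof. by move=> vS; rewrite /frame_op big_setU1. Qed.

(** The twin receives the vector of [s], and [s] gives it half of its weight. *)
Lemma has_weighted_rep_twin S G (v s : T) :
    v \notin S -> s \in S -> {in S, forall x, edge v x = edge s x} ->
  has_weighted_rep S G -> has_weighted_rep (v |: S) G.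
Proof.
move=> vS sS twin [c [u [c_gt0 orth_u defG]]].
pose u' x := if x == v then u s else u x.
pose c' x := if (x == v) || (x == s) then c s / 2 else c x.
have neq_v x : x \in S -> (x == v) = false.
  by move=> xS; apply: contraNF vS => /eqP <-.
exists c', u'; split.
- move=> x; rewrite !inE /c'; have [//|_ /= xS] := eqVneq x v.
    by rewrite divr_gt0 ?c_gt0.
  by case: ifP => _; rewrite ?divr_gt0 ?c_gt0.
- move=> x y /setU1P[->|xS] /setU1P[->|yS]; rewrite /u' ?eqxx ?neq_v //.
  + by rewrite orth_u // !edge_irrefl.
  + by rewrite orth_u // twin.
  + by rewrite orth_u // [RHS]edge_sym twin // edge_sym.
  + exact: orth_u.
rewrite -defG frame_opU1 // /frame_op (bigD1 s) //= [in RHS](bigD1 s) //=.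
rewrite addrA /u' /c' !eqxx orbT /= (neq_v s) // -scalerDl; congr (_ *: _ + _).
  by field.
apply: eq_bigr => x /andP[xS /negPf x_s].
by rewrite x_s neq_v.
Qed.

(** Representations that can be extended at any vertex: non-collinearity leaves
    room for a new vector orthogonal to a given one and to no other, and spanning
    allows the weights to absorb its contribution to [G]. *)
Definition robust_rep S G : Prop :=
  exists (c : T -> R) (u : T -> 'rV[R]_3),
    [/\ [/\ {in S, forall x, 0 < c x}, orthogonal_rep S u & frame_op S c u = G],
        {in S &, forall x y, x != y -> cross (u x) (u y) != 0}
      & forall M : 'M[R]_3, M^T = M -> exists t : T -> R, frame_op S t u = M].

Lemma robust_has_frame S G : robust_rep S G -> has_weighted_rep S G.
Proof. by move=> [c [u [? _ _]]]; exists c, u. Qed.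

Lemma small_multiple (s : seq T) (c t : T -> R) :
  {in s, forall x, 0 < c x} ->
  exists2 e, 0 < e & {in s, forall x, e * t x < c x}.
Proof.
elim: s => [|x s IHs] c_gt0; first by exists 1.
have [y ys|e e_gt0 lt_e] := IHs; first by apply: c_gt0; rewrite inE ys orbT.
have cx : 0 < c x by apply: c_gt0; rewrite mem_head.
have tx : 0 < `|t x| + 1 by rewrite ltr_wpDl.
have e'_gt0 : 0 < Num.min e (c x / (`|t x| + 1)).
  by rewrite lt_min e_gt0 divr_gt0.
exists (Num.min e (c x / (`|t x| + 1))) => // y; rewrite inE => /orP[/eqP->|ys].
  apply: (@le_lt_trans _ _ (Num.min e (c x / (`|t x| + 1)) * `|t x|)).
    by rewrite ler_wpM2l ?ler_norm // ltW.
  apply: (@lt_le_trans _ _ (Num.min e (c x / (`|t x| + 1)) * (`|t x| + 1))).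
    by rewrite ltr_pM2l // ltrDl.
  by rewrite -ler_pdivlMr // ge_min lexx orbT.
have [ty|ty] := lerP (t y) 0.
  apply: (@le_lt_trans _ _ 0); last by apply: c_gt0; rewrite inE ys orbT.
  by rewrite mulr_ge0_le0 // ltW.
apply: le_lt_trans (lt_e y ys); rewrite ler_pM2r // ge_min lexx //.
Qed.

(** The new vector [x] is generic in the plane orthogonal to the parent and gets
    a small weight [e]. If the [t w] express [x^T x] through the old vectors,
    changing the old weights [c w] to [c w - e t w] restores [G]. *)
Lemma robust_rep_leaf S G (v p : T) :
    v \notin S -> p \in S -> {in S, forall x, edge v x = (x == p)} ->
  robust_rep S G -> robust_rep (v |: S) G.
Proof.
move=> vS pS leaf [c [u [[c_gt0 orth_u defG] nonpar span]]].
have u_neq0 x : x \in S -> u x != 0.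
  by move=> xS; rewrite -dot_eq0 orth_u // edge_irrefl.
have neq_v x : x \in S -> (x == v) = false.
  by move=> xS; apply: contraNF vS => /eqP <-.
have [|x [x_neq0 xp nonpar_x orth_x]] :=
    @generic_orthogonal R (u p) [seq u w | w in S] (u_neq0 p pS).
  by move=> _ /mapP[w + ->]; rewrite mem_enum; apply: u_neq0.
have [t def_t] : exists t : T -> R, frame_op S t u = x^T *m x.
  by apply: span; rewrite trmx_mul trmxK.
have [|e e_gt0 lt_e] := @small_multiple (enum S) c t.
  by move=> w; rewrite mem_enum; apply: c_gt0.
pose u' w := if w == v then x else u w.
pose c' w := if w == v then e else c w - e * t w.
have u'v : u' v = x by rewrite /u' eqxx.
have u'S w : w \in S -> u' w = u w by move=> wS; rewrite /u' neq_v.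
have frame_u' d : frame_op S d u' = frame_op S d u.
  by apply: eq_bigr => w wS; rewrite u'S.
exists c', u'; split.
- split.
  + move=> w; rewrite !inE /c'; case: eqVneq => [//|_ /= wS].
    by rewrite subr_gt0 lt_e // mem_enum.
  + have orth_xS w : w \in S -> (dot x (u w) == 0) = edge v w.
      move=> wS; rewrite leaf //; have [->|w_p] := eqVneq w p.
        by rewrite xp eqxx.
      by apply/negbTE/orth_x; rewrite ?(map_f u) ?mem_enum // nonpar.
    move=> w z /setU1P[->|wS] /setU1P[->|zS].
    * by rewrite u'v dot_eq0 (negPf x_neq0) edge_irrefl.
    * by rewrite u'v u'S // orth_xS.
    * by rewrite u'v u'S // dotC orth_xS // edge_sym.
    * by rewrite !u'S // orth_u.
  + rewrite frame_opU1 // frame_u' u'v /c' eqxx -defG -def_t /frame_op.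
    rewrite scaler_sumr -big_split; apply: eq_bigr => w wS /=.
    by rewrite neq_v // scalerA -scalerDl addrC subrK.
- move=> w z /setU1P[->|wS] /setU1P[->|zS] neq_wz.
  + by rewrite eqxx in neq_wz.
  + by rewrite u'v u'S // nonpar_x // (map_f u) ?mem_enum.
  + by rewrite u'v u'S // cross_eq0C nonpar_x // (map_f u) ?mem_enum.
  + by rewrite !u'S // nonpar.
- move=> M /(span M)[r defM]; exists (fun w => if w == v then 0 else r w).
  rewrite frame_opU1 // eqxx scale0r add0r frame_u' -defM.
  by apply: eq_bigr => w wS; rewrite neq_v.
Qed.

End Extension.

(** * Explicit representations of small trees *)

Section IntegerFrames.
Variables (R : realType) (T : sgraph) (x0 : T).
Implicit Types (par ws : seq nat) (vs : seq (seq int)) (a b d : seq int).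

Definition int_vector a : 'rV[R]_3 := \row_k (a`_k)%:~R.

Definition int_dot a b : int := a`_0 * b`_0 + a`_1 * b`_1 + a`_2 * b`_2.

Definition int_cross a b : seq int :=
  [:: a`_1 * b`_2 - a`_2 * b`_1; a`_2 * b`_0 - a`_0 * b`_2;
      a`_0 * b`_1 - a`_1 * b`_0].

Lemma dot_int_vector a b : dot (int_vector a) (int_vector b) = (int_dot a b)%:~R.
Proof. by rewrite dot3E !mxE /= !rmorphD !rmorphM. Qed.

Lemma cross_int_vector a b :
  cross (int_vector a) (int_vector b) = int_vector (int_cross a b).
Proof. by apply: row3P; rewrite !mxE /= rmorphB !rmorphM. Qed.

(** The representations of the small trees have integer coordinates and weights,
    so that orthogonality, [G] and non-collinearity are decided by computation
    on [int]. *)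
Definition int_rep_check par vs : bool :=
  all (fun i => all (fun j =>
    (int_dot (nth [::] vs i) (nth [::] vs j) == 0) == par_adj par i j)
    (iota 0 (size vs))) (iota 0 (size vs)).

Definition int_frame_op_check ws vs d : bool :=
  all (fun i => 0 < nth 0 ws i)%N (iota 0 (size vs)) &&
  all (fun k => all (fun l =>
    foldr (fun i z => (nth 0%N ws i)%:Z * ((nth [::] vs i)`_k * (nth [::] vs i)`_l) + z) 0
          (iota 0 (size vs))
    == if k == l then d`_k else 0) (iota 0 3)) (iota 0 3).

Definition int_noncollinear vs : bool :=
  all (fun i => all (fun j =>
    (i == j) || (int_cross (nth [::] vs i) (nth [::] vs j) != [:: 0; 0; 0]))
    (iota 0 (size vs))) (iota 0 (size vs)).

Lemma foldr_sumE (V : nmodType) (r : seq nat) (f : nat -> V) :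
  foldr (fun i z => f i + z) 0 r = \sum_(i <- r) f i.
Proof. by elim: r => [|i r /= ->]; rewrite ?big_nil ?big_cons. Qed.

Hypothesis acycT : acyclic T.
Variables (par ws : seq nat) (s : seq T) (vs : seq (seq int)) (d : seq int).
Hypotheses (list_s : listing x0 par s) (size_s : size s = size vs).
Hypotheses (rep : int_rep_check par vs) (frm : int_frame_op_check ws vs d).

Let u (x : T) : 'rV[R]_3 := int_vector (nth [::] vs (index x s)).
Let c (x : T) : R := (nth 0%N ws (index x s))%:R.

Lemma frame_op_listing (f : nat -> R) :
  frame_op [set x in s] (fun x => f (index x s)) u =
  \sum_(i < size vs)
     f i *: ((int_vector (nth [::] vs i))^T *m int_vector (nth [::] vs i)).
Proof.
have uniq_s : uniq s by case/andP: list_s.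
rewrite /frame_op /u; under eq_bigl do rewrite inE.
rewrite -big_uniq //= (big_nth x0) big_mkord -size_s; apply: eq_bigr => i _.
by rewrite index_uniq.
Qed.

Lemma index_listing x : x \in [set x in s] -> index x s \in iota 0 (size vs).
Proof. by rewrite inE -index_mem mem_iota -size_s. Qed.

Lemma frame_listing :
  [/\ {in [set x in s], forall x, 0 < c x}, orthogonal_rep [set x in s] u
    & frame_op [set x in s] c u = diag_mx (int_vector d)].
Proof.
have /andP[/allP ws_gt0 /allP sum_d] := frm.
split=> [x xs|x y xs ys|]; first by rewrite ltr0n ws_gt0 ?index_listing.
  rewrite dot_int_vector intr_eq0.
  have /allP/(_ _ (index_listing xs))/allP/(_ _ (index_listing ys))/eqP-> := rep.
  move: xs ys; rewrite !inE => xs ys.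
  by rewrite -(listing_edge acycT list_s) ?index_mem // !nth_index.
apply: (etrans (frame_op_listing (fun i => (nth 0%N ws i)%:R))).
apply/matrixP => k l; rewrite summxE !mxE.
have in3 (m : 'I_3) : val m \in iota 0 3 by rewrite mem_iota ltn_ord.
have /allP/(_ _ (in3 l))/eqP := sum_d _ (in3 k).
rewrite foldr_sumE => /(congr1 (fun z : int => z%:~R : R)).
rewrite rmorph_sum /= (_ : (if _ then _ else _)%:~R = (d`_k)%:~R *+ (k == l)).
  move <-; rewrite -[X in iota _ X]subn0 big_mkord; apply: eq_bigr => i _.
  by rewrite !mxE big_ord1 !mxE !rmorphM.
by rewrite -[(_ == _ :> nat)]/(k == l); case: (k == l).
Qed.

Lemma has_weighted_rep_listing : has_weighted_rep [set x in s] (diag_mx (int_vector d)).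
Proof. by exists c, u; have [] := frame_listing. Qed.

Lemma robust_rep_listing :
    int_noncollinear vs ->
    (forall M : 'M[R]_3, M^T = M -> exists t : nat -> R, M =
       \sum_(i < size vs)
         t i *: ((int_vector (nth [::] vs i))^T *m int_vector (nth [::] vs i))) ->
  robust_rep [set x in s] (diag_mx (int_vector d)).
Proof.
move=> noncol span; exists c, u; split; first exact: frame_listing.
- move=> x y xs ys neq_xy; rewrite /u cross_int_vector.
  have := allP (allP noncol _ (index_listing xs)) _ (index_listing ys).
  case/orP=> [/eqP eq_ix|].
    move: xs ys neq_xy; rewrite !inE => xs ys.
    by rewrite -(nth_index x0 xs) eq_ix nth_index ?eqxx.
  apply: contra_neq => /rowP v0.
  have := v0 0; have := v0 1; have := v0 2; rewrite !mxE /=.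
  rewrite /int_cross; do 3!(move/eqP; rewrite intr_eq0 => /eqP->).
  by [].
- move=> M /(span M)[t ->]; exists (fun x => t (index x s)).
  exact: frame_op_listing.
Qed.

End IntegerFrames.

Section Bases.
Variables (R : realType) (T : sgraph) (x0 : T).
Hypothesis acycT : acyclic T.
Implicit Types s : seq T.

Lemma sym_matrix3P (M N : 'M[R]_3) :
    M^T = M -> N^T = N ->
    M 0 0 = N 0 0 -> M 1 1 = N 1 1 -> M 2 2 = N 2 2 ->
    M 0 1 = N 0 1 -> M 0 2 = N 0 2 -> M 1 2 = N 1 2 ->
  M = N.
Proof.
move=> symM symN e00 e11 e22 e01 e02 e12; apply/matrixP => k l.
have sym (k' l' : 'I_3) : M k' l' = N k' l' -> M l' k' = N l' k'.
  by move=> e; rewrite -symM -symN !mxE.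
have := mem_ord3 k; have := mem_ord3 l; rewrite !inE.
by case/or3P=> /eqP->; case/or3P=> /eqP->; do ?[assumption | apply: sym].
Qed.

(** Spanning is shown by solving, for a symmetric [M], the six linear equations
    that express [M] through the given vectors. *)
Lemma sum_int_vectorsE (vs : seq (seq int)) (t : nat -> R) (M : 'M[R]_3) :
    let entry k l := foldr (fun i z => t i * (((nth [::] vs i)`_k)%:~R *
                              ((nth [::] vs i)`_l)%:~R) + z) 0 (iota 0 (size vs)) in
    M^T = M ->
    M 0 0 = entry 0%N 0%N -> M 1 1 = entry 1%N 1%N -> M 2 2 = entry 2%N 2%N ->
    M 0 1 = entry 0%N 1%N -> M 0 2 = entry 0%N 2%N -> M 1 2 = entry 1%N 2%N ->
  M = \sum_(i < size vs)
        t i *: ((int_vector R (nth [::] vs i))^T *m int_vector R (nth [::] vs i)).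
Proof.
move=> entry symM e00 e11 e22 e01 e02 e12.
have entryE (k l : 'I_3) : (\sum_(i < size vs)
    t i *: ((int_vector R (nth [::] vs i))^T *m int_vector R (nth [::] vs i))) k l
    = entry k l.
  rewrite summxE /entry foldr_sumE -[X in iota _ X]subn0 big_mkord.
  by apply: eq_bigr => i _; rewrite !mxE big_ord1 !mxE.
apply: sym_matrix3P; rewrite ?entryE //.
rewrite raddf_sum; apply: eq_bigr => i _ /=.
by rewrite linearZ /= trmx_mul trmxK.
Qed.

(** In the next three lemmas [t] solves the equations of [sum_int_vectorsE]: its
    coefficients are those of the inverse of the matrix of moments
    [(x^2, y^2, z^2, xy, xz, yz)] of six of the vectors. *)
Lemma robust_rep_path6 s :
    listing x0 [:: 0; 0; 1; 2; 3; 4]%N s -> size s = 6 ->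
  robust_rep [set x in s] (diag_mx (int_vector R [:: 7; 7; 7])).
Proof.
move=> list_s size_s.
apply: (robust_rep_listing acycT (ws := [:: 2; 1; 3; 1; 1; 1])
  (vs := [:: [:: 0; 1; -1]; [:: 1; 0; 0]; [:: 0; 0; 1]; [:: 2; -1; 0];
             [:: 1; 2; 1]; [:: 1; 0; -1]])
  list_s) => // M symM.
exists (fun i =>
  [:: (4 * M 1 1 + 2 * M 0 1 - 10 * M 1 2) / 14;
   (14 * M 0 0 - 12 * M 1 1 + 22 * M 0 1 + 14 * M 0 2 - 12 * M 1 2) / 14;
   (- 8 * M 1 1 + 14 * M 2 2 - 4 * M 0 1 + 14 * M 0 2 + 6 * M 1 2) / 14;
   (2 * M 1 1 - 6 * M 0 1 + 2 * M 1 2) / 14;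
   (2 * M 1 1 + M 0 1 + 2 * M 1 2) / 14;
   (2 * M 1 1 + M 0 1 - 14 * M 0 2 + 2 * M 1 2) / 14]`_i).
by apply: sum_int_vectorsE => //=; lra.
Qed.

Lemma robust_rep_W22 s :
    listing x0 [:: 0; 0; 0; 1; 1; 2; 2]%N s -> size s = 7 ->
  robust_rep [set x in s] (diag_mx (int_vector R [:: 14; 14; 14])).
Proof.
move=> list_s size_s.
apply: (robust_rep_listing acycT (ws := [:: 1; 1; 2; 1; 1; 2; 2])
  (vs := [:: [:: 0; 1; -1]; [:: 0; 1; 1]; [:: 2; -1; -1]; [:: 1; -1; 1];
             [:: 1; 1; -1]; [:: 1; 0; 2]; [:: 1; 2; 0]])
  list_s) => // M symM.
exists (fun i =>
  [:: (- 8 * M 0 0 - 2 * M 1 1 + 6 * M 2 2 - 8 * M 0 1 - 8 * M 0 2 - 4 * M 1 2) / 8;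
   (5 * M 1 1 - M 2 2 + 2 * M 0 1 + 2 * M 0 2 + 4 * M 1 2) / 8;
   (- M 1 1 + M 2 2 - 2 * M 0 1 - 2 * M 0 2) / 8;
   (4 * M 0 0 + 4 * M 1 1 - 4 * M 2 2 + 2 * M 0 1 + 6 * M 0 2) / 8;
   (4 * M 0 0 + 2 * M 1 1 - 2 * M 2 2 + 6 * M 0 1 + 2 * M 0 2) / 8;
   (- 2 * M 1 1 + 2 * M 2 2) / 8;
   0]`_i).
by apply: sum_int_vectorsE => //=; lra.
Qed.

Lemma robust_rep_spider s :
    listing x0 [:: 0; 0; 0; 0; 1; 2; 3]%N s -> size s = 7 ->
  robust_rep [set x in s] (diag_mx (int_vector R [:: 8; 8; 8])).
Proof.
move=> list_s size_s.
apply: (robust_rep_listing acycT (ws := [:: 5; 1; 1; 1; 1; 1; 1])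
  (vs := [:: [:: 0; 0; 1]; [:: 0; 1; 0]; [:: 1; -1; 0]; [:: 1; -2; 0];
             [:: 1; 0; -1]; [:: 1; 1; -1]; [:: 2; 1; 1]])
  list_s) => // M symM.
exists (fun i =>
  [:: M 2 2 + M 0 2;
   2 * M 0 0 + M 1 1 + 3 * M 0 1 + 2 * M 0 2 + 4 * M 1 2;
   2 * M 0 0 + M 0 1 + 2 * M 0 2 + M 1 2;
   - M 0 0 - M 0 1 - M 0 2 - M 1 2;
   - M 0 2 + M 1 2;
   - M 1 2;
   0]`_i).
by apply: sum_int_vectorsE => //=; lra.
Qed.

(** A star is obtained from this edge by adding twins of one end; its vectors
    span only a plane, whence the zero in [G]. *)
Lemma has_weighted_rep_edge s :
    listing x0 [:: 0; 0]%N s -> size s = 2 ->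
  has_weighted_rep [set x in s] (diag_mx (int_vector R [:: 1; 1; 0])).
Proof.
move=> list_s size_s.
exact: (has_weighted_rep_listing R acycT (ws := [:: 1; 1])
  (vs := [:: [:: 1; 0; 0]; [:: 0; 1; 0]])
  list_s).
Qed.

Lemma has_weighted_rep_double_star s :
    listing x0 [:: 0; 0; 0; 0; 1; 1]%N s -> size s = 6 ->
  has_weighted_rep [set x in s] (diag_mx (int_vector R [:: 7; 7; 7])).
Proof.
move=> list_s size_s.
exact: (has_weighted_rep_listing R acycT (ws := [:: 3; 2; 2; 1; 1; 1])
  (vs := [:: [:: 0; 1; -1]; [:: 1; -1; -1]; [:: 1; 0; 0]; [:: 1; 1; 1];
             [:: 1; 0; 1]; [:: 1; 1; 0]])
  list_s).
Qed.

Lemma has_weighted_rep_path5 s :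
    listing x0 [:: 0; 0; 1; 2; 3]%N s -> size s = 5 ->
  has_weighted_rep [set x in s] (diag_mx (int_vector R [:: 6; 8; 6])).
Proof.
move=> list_s size_s.
exact: (has_weighted_rep_listing R acycT (ws := [:: 1; 2; 2; 2; 1])
  (vs := [:: [:: 1; -1; -1]; [:: 0; 1; -1]; [:: 1; 1; 1]; [:: 1; -1; 0];
             [:: 1; 1; -1]])
  list_s).
Qed.

(** The tree [S^2_{2,1}]. *)
Lemma has_weighted_rep_chair s :
    listing x0 [:: 0; 0; 0; 1; 0]%N s -> size s = 5 ->
  has_weighted_rep [set x in s] (diag_mx (int_vector R [:: 4; 3; 3])).
Proof.
move=> list_s size_s.
exact: (has_weighted_rep_listing R acycT (ws := [:: 1; 1; 1; 1; 1])
  (vs := [:: [:: 1; -1; -1]; [:: 0; 1; -1]; [:: 1; 0; 1]; [:: 1; 0; 0];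
             [:: 1; 1; 0]])
  list_s).
Qed.

(** The path on 5 vertices with a leaf added at its centre. *)
Lemma has_weighted_rep_path5_leaf s :
    listing x0 [:: 0; 0; 1; 2; 3; 2]%N s -> size s = 6 ->
  has_weighted_rep [set x in s] (diag_mx (int_vector R [:: 5; 5; 7])).
Proof.
move=> list_s size_s.
exact: (has_weighted_rep_listing R acycT (ws := [:: 1; 2; 1; 2; 1; 1])
  (vs := [:: [:: 0; 1; -1]; [:: 0; 1; 1]; [:: 1; -1; 1]; [:: 1; 0; -1];
             [:: 1; 0; 1]; [:: 1; 1; 0]])
  list_s).
Qed.

End Bases.

Section FrameGrowth.
Variables (R : realType) (T : sgraph).
Hypotheses (acycT : acyclic T) (connT : connected T).
Implicit Types (S H : {set T}) (G : 'M[R]_3).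

Lemma robust_rep_setT S G :
    S != finset.set0 -> connected_set S -> robust_rep S G ->
  has_weighted_rep [set: T] G.
Proof.
move=> S0 connS rob; apply: robust_has_frame.
apply: (@tree_growth _ acycT (fun S' => robust_rep S' G) S) => //.
by move=> S' v p _ _ vS' pS' _ leaf; apply: robust_rep_leaf leaf.
Qed.

(** If everything outside [S] hangs on a set [H] of hubs, each of which already
    has a leaf in [S], then the whole tree is obtained by adding twins. *)
Lemma has_weighted_rep_leaves S H G :
    S != finset.set0 -> connected_set S -> H \subset S ->
    (forall v, v \notin S -> exists2 p, p \in H & edge v p) ->
    (forall p, p \in H -> exists s, [/\ s \in S, s \notin H
                                   & {in S, forall x, edge s x = (x == p)}]) ->
  has_weighted_rep S G -> has_weighted_rep [set: T] G.
Proof.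
move=> S0 connS /fintype.subsetP sHS hub leafH frameS.
pose P (S' : {set T}) := has_weighted_rep S' G /\
  forall p, p \in H -> exists s, [/\ s \in S', s \notin H
                              & {in S', forall x, edge s x = (x == p)}].
have [] // : P [set: T].
apply: (tree_growth acycT connT S0 connS) => //.
move=> S' v p /fintype.subsetP sSS' _ vS' pS' vp leaf_v [frameS' leafS'].
have pH : p \in H.
  have [|q qH vq] := hub v; first by apply: contra vS' => /sSS'.
  by have := leaf_v q (sSS' _ (sHS _ qH)); rewrite vq => /esym/eqP<-.
split.
  have [s [sS' _ leaf_s]] := leafS' p pH.
  by apply: has_weighted_rep_twin sS' _ frameS' => // x xS'; rewrite leaf_v ?leaf_s.
move=> q qH; have [s [sS' sH leaf_s]] := leafS' q qH.
exists s; split=> // [|x /setU1P[->|]]; first by rewrite !inE sS' orbT.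
  rewrite edge_sym leaf_v // [s == p]eq_sym (negPf (memPn sH p pH)).
  by apply/esym/negbTE; apply: contraNneq vS' => ->; apply/sSS'/sHS.
exact: leaf_s.
Qed.

Lemma q_compl_le_int_diag (d s : seq int) :
    has_weighted_rep [set: T] (diag_mx (int_vector R d)) ->
    all (fun k => d`_k \in 0 :: s) (iota 0 3) ->
  (q_graph R (compl T) <= (size s).+1)%N.
Proof.
move=> frameT /allP d_s.
rewrite -(size_map (fun z : int => z%:~R : R)).
apply: q_compl_le_weighted_rep frameT _ => a a0 /eigenvalue_diag[k def_a].
rewrite {}def_a !mxE in a0 *; rewrite map_f //.
have := d_s k; rewrite mem_iota ltn_ord inE => /(_ isT)/predU1P[dk0|//].
by rewrite dk0 eqxx in a0.
Qed.

Lemma listing_leaf x0 (par : seq nat) (s : seq T) (i p : nat) :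
    listing x0 par s -> (i < size s)%N -> (p < size s)%N ->
    all (fun j => par_adj par i j == (j == p)) (iota 0 (size s)) ->
  {in [set x in s], forall x, edge (nth x0 s i) x = (x == nth x0 s p)}.
Proof.
move=> list_s lt_i lt_p /allP leaf x; rewrite inE => /(nthP x0)[j lt_j <-].
rewrite (listing_edge acycT list_s) // (eqP (leaf j _)) ?mem_iota //.
by rewrite nth_uniq //; case/andP: list_s.
Qed.

(** A hub is given by its position together with that of one of its leaves. *)
Lemma has_weighted_rep_listing_leaves x0 (par : seq nat) (s : seq T)
    (hubs : seq (nat * nat)) G :
    listing x0 par s -> (0 < size s)%N ->
    all (fun h => [&& (h.1 < size s)%N, (h.2 < size s)%N, h.2 \notin unzip1 hubs
         & all (fun j => par_adj par h.2 j == (j == h.1)) (iota 0 (size s))]) hubs ->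
    (forall v, v \notin s -> has (fun h => edge v (nth x0 s h.1)) hubs) ->
  has_weighted_rep [set x in s] G -> has_weighted_rep [set: T] G.
Proof.
move=> list_s s_gt0 /allP hubsP hub.
have uniq_s : uniq s by case/andP: list_s.
apply: (has_weighted_rep_leaves (S := [set x in s])
  (H := [set x in [seq nth x0 s h.1 | h <- hubs]])).
- by apply/finset.set0Pn; exists (nth x0 s 0); rewrite inE mem_nth.
- exact: (listing_connected list_s s_gt0).
- apply/fintype.subsetP => _ /[!inE] /mapP[h /hubsP/and4P[lt_p _ _ _] ->].
  exact: mem_nth.
- move=> v; rewrite inE => /hub/hasP[h h_in vh].
  by exists (nth x0 s h.1); rewrite // inE (map_f (fun h => nth x0 s h.1) h_in).
move=> _ /[!inE] /mapP[h /hubsP/and4P[lt_p lt_i i_hubs leaf_i] ->].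
exists (nth x0 s h.2); split; first by rewrite inE mem_nth.
  rewrite inE; apply: contra i_hubs => /mapP[h' h'_in /eqP].
  have /and4P[lt_p' _ _ _] := hubsP h' h'_in.
  by rewrite nth_uniq // => /eqP->; apply: map_f.
exact: listing_leaf list_s lt_i lt_p leaf_i.
Qed.

End FrameGrowth.

(** * Upper bounds *)

Section ThreeEigenvalues.
Variables (R : realType) (T : sgraph).
Hypotheses (connT : connected T) (acycT : acyclic T).
Implicit Types a b c v w x y : T.

(** The tree is a path [w c a b] with leaves added at [a] and [b]; which of the
    two receive some decides the small tree to start from, and neither does only
    in [P_4]. *)
Lemma q_compl_le3 :
    has_near_dominating_edge T -> ~ isomorphic T (path_graph 4) ->
  (q_graph R (compl T) <= 3)%N.
Proof.
move=> /(near_dominating_listing connT acycT)[w [c [a [b [list4 dom]]]]] notP4.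
have notin4 v : v \notin [:: w; c; a; b] -> [/\ v != w, v != c, v != a & v != b].
  by rewrite !inE !negb_or => /and4P.
have [[l l4 la]|noL] := pselect (exists2 l, l \notin [:: w; c; a; b] & edge l a);
have [[d d4 db]|noD] := pselect (exists2 d, d \notin [:: w; c; a; b] & edge d b).
- have [_ lc _ lb] := notin4 l l4; have [_ _ da _] := notin4 d d4.
  have list5 : listing w [:: 0; 0; 1; 2; 3]%N [:: w; c; a; b; d].
    by apply: (listing_rcons acycT list4 (p := 3%N)); rewrite //= da.
  have list6 : listing w [:: 0; 0; 1; 2; 3; 2]%N [:: w; c; a; b; d; l].
    by apply: (listing_rcons acycT list5 (p := 2%N)); rewrite //= lc lb.
  apply: (q_compl_le_int_diag (d := [:: 5; 5; 7]) (s := [:: 5; 7])) => //.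
  have := has_weighted_rep_path5_leaf R acycT list6 erefl.
  apply: (has_weighted_rep_listing_leaves acycT connT
    (hubs := [:: (2, 5); (3, 4)]) list6) => //= v v6.
  rewrite orbF; apply: dom; apply: contra v6.
  by rewrite !inE => /or4P[]->; rewrite ?orbT.
- have [_ lc _ lb] := notin4 l l4.
  have list5 : listing w [:: 0; 0; 0; 1; 0]%N [:: a; c; b; w; l].
    have /andP[/and4P[/= w_cab c_ab _ _] _] := list4.
    have l2 : listing w [:: 0; 0]%N [:: a; c].
      by apply: listing2; rewrite (listing_edge acycT list4 (i := 2) (j := 1)).
    have l3 : listing w [:: 0; 0; 0]%N [:: a; c; b].
      apply: (listing_rcons acycT l2 (p := 0%N)) => //=.
        by rewrite (listing_edge acycT list4 (i := 3) (j := 2)).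
      by rewrite eq_sym; move: c_ab; rewrite !inE negb_or => /andP[_ ->].
    have l4' : listing w [:: 0; 0; 0; 1]%N [:: a; c; b; w].
      apply: (listing_rcons acycT l3 (p := 1%N)) => //=.
        by rewrite (listing_edge acycT list4 (i := 0) (j := 1)).
      by move: w_cab; rewrite !inE !negb_or => /and3P[_ -> _].
    by apply: (listing_rcons acycT l4' (p := 0%N)); rewrite //= lc lb.
  apply: (q_compl_le_int_diag (d := [:: 4; 3; 3]) (s := [:: 4; 3])) => //.
  have := has_weighted_rep_chair R acycT list5 erefl.
  apply: (has_weighted_rep_listing_leaves acycT connT
    (hubs := [:: (0, 2)]) list5) => //= v v5.
  have v4 : v \notin [:: w; c; a; b].
    by apply: contra v5; rewrite !inE => /or4P[]->; rewrite ?orbT.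
  rewrite orbF; case/orP: (dom v v4) => // vb.
  by case: noD; exists v.
- have [_ _ da _] := notin4 d d4.
  have list5 : listing w [:: 0; 0; 1; 2; 3]%N [:: w; c; a; b; d].
    by apply: (listing_rcons acycT list4 (p := 3%N)); rewrite //= da.
  apply: (q_compl_le_int_diag (d := [:: 6; 8; 6]) (s := [:: 6; 8])) => //.
  have := has_weighted_rep_path5 R acycT list5 erefl.
  apply: (has_weighted_rep_listing_leaves acycT connT
    (hubs := [:: (3, 4)]) list5) => //= v v5.
  have v4 : v \notin [:: w; c; a; b].
    by apply: contra v5; rewrite !inE => /or4P[]->; rewrite ?orbT.
  rewrite orbF; case/orP: (dom v v4) => // va.
  by case: noL; exists v.
case: notP4; apply: (path4_listing acycT list4) => v.
apply: contrapT => /negP v4; case/orP: (dom v v4) => [va|vb].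
  by case: noL; exists v.
by case: noD; exists v.
Qed.

End ThreeEigenvalues.

Section TwoEigenvalues.
Variables (R : realType) (T : sgraph).
Hypotheses (connT : connected T) (acycT : acyclic T).
Implicit Types a b c v w x y p q r : T.

Let tight : Prop :=
  exists k : int, has_weighted_rep [set: T] (diag_mx (int_vector R [:: k; k; k])).

Lemma tight_robust x (par : seq nat) (s : seq T) (k : int) :
    listing x par s -> (0 < size s)%N ->
    robust_rep [set y in s] (diag_mx (int_vector R [:: k; k; k])) ->
  tight.
Proof.
move=> list_s s_gt0 rob; exists k.
apply: (robust_rep_setT acycT connT) rob; last exact: listing_connected list_s s_gt0.
by apply/finset.set0Pn; exists (nth x s 0); rewrite inE mem_nth.
Qed.

Lemma tight_double_star a b l l' d d' :
    edge a b -> edge l a -> edge l' a -> edge d b -> edge d' b ->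
    l != b -> l' != b -> l' != l -> d != a -> d' != a -> d' != d ->
    (forall v, edge v a || edge v b) ->
  tight.
Proof.
move=> ab la l'a db d'b lb l'b l'l da d'a d'd dom.
have l2 := listing2 a ab.
have l3 : listing a [:: 0; 0; 0]%N [:: a; b; l].
  by apply: (listing_rcons acycT l2 (p := 0%N)); rewrite //= lb.
have l4 : listing a [:: 0; 0; 0; 0]%N [:: a; b; l; l'].
  by apply: (listing_rcons acycT l3 (p := 0%N)); rewrite //= l'b l'l.
have l5 : listing a [:: 0; 0; 0; 0; 1]%N [:: a; b; l; l'; d].
  by apply: (listing_rcons acycT l4 (p := 1%N)); rewrite //= da.
have l6 : listing a [:: 0; 0; 0; 0; 1; 1]%N [:: a; b; l; l'; d; d'].
  by apply: (listing_rcons acycT l5 (p := 1%N)); rewrite //= d'a d'd.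
exists 7; have := has_weighted_rep_double_star R acycT l6 erefl.
apply: (has_weighted_rep_listing_leaves acycT connT
  (hubs := [:: (0, 2); (1, 4)]) l6) => //= v _.
by rewrite orbF.
Qed.

Lemma q_compl_star a b :
    edge a b -> (forall v, v != a -> edge v a) ->
  (q_graph R (compl T) <= 2)%N.
Proof.
move=> ab dom; have l2 := listing2 a ab.
apply: (q_compl_le_int_diag (d := [:: 1; 1; 0]) (s := [:: 1])) => //.
have := has_weighted_rep_edge R acycT l2 erefl.
apply: (has_weighted_rep_listing_leaves acycT connT
  (hubs := [:: (0, 1)]) l2) => //= v.
by rewrite orbF inE negb_or => /andP[/dom].
Qed.

Section NoDominatingEdge.
Hypothesis two_outside : forall a b w, edge a b ->
  exists v, [/\ v != w, ~~ edge v a & ~~ edge v b].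

Lemma outside_neighbour a b : edge a b ->
  exists x y, [/\ edge x y, ~~ edge x a, ~~ edge x b, y != a /\ y != b
              & edge y a || edge y b].
Proof.
move=> ab; have [w [_ wa wb]] := two_outside a ab.
have [x [y [Nx Ny xy]]] := @connected_boundary T (fun v => edge v a || edge v b) a w
  connT (introT orP (or_intror ab)) (introT norP (conj wa wb)).
move: Nx; rewrite negb_or => /andP[xa xb]; exists x, y; split=> //.
by split; [apply: contraNneq xa | apply: contraNneq xb] => <-.
Qed.

(** A vertex at distance 2 from an edge gives a path on 4 vertices, and one at
    distance 2 from the suitable edge of that path extends it to 5. *)
Lemma centered_path5 a b : edge a b ->
  exists r p q p1 q1, listing r [:: 0; 0; 0; 1; 2]%N [:: r; p; q; p1; q1].
Proof.
move=> ab; have [x [y [xy xa xb [y_a y_b] y_ab]]] := outside_neighbour ab.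
wlog ya : a b ab xa xb y_a y_b y_ab / edge y a.
  move=> wlog_ab; case/orP: (y_ab) => [ya|yb]; first exact: (wlog_ab a b).
  by apply: (wlog_ab b a); rewrite // 1?orbC // edge_sym.
have [x' [y' [x'y' x'y x'a [y'_y y'_a]]]] := outside_neighbour ya.
case/orP=> [y'y|y'a].
  exists y, a, y', b, x'.
  have l2 := listing2 y ya.
  have l3 : listing y [:: 0; 0; 0]%N [:: y; a; y'].
    by apply: (listing_rcons acycT l2 (p := 0%N)); rewrite //= y'_a.
  have l4 : listing y [:: 0; 0; 0; 1]%N [:: y; a; y'; b].
    by apply: (listing_rcons acycT l3 (p := 1%N)); rewrite //= 1?edge_sym // eq_sym y_b.
  apply: (listing_rcons acycT l4 (p := 2%N)); rewrite //= andbT.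
  by apply: contraNneq x'a => ->.
exists a, y, y', x, x'.
have l2 : listing a [:: 0; 0]%N [:: a; y] by apply: listing2; rewrite edge_sym.
have l3 : listing a [:: 0; 0; 0]%N [:: a; y; y'].
  by apply: (listing_rcons acycT l2 (p := 0%N)); rewrite //= y'_y.
have l4 : listing a [:: 0; 0; 0; 1]%N [:: a; y; y'; x].
  apply: (listing_rcons acycT l3 (p := 1%N)); rewrite //= andbT.
  by apply: contraNneq xb => ->.
apply: (listing_rcons acycT l4 (p := 2%N)); rewrite //= andbT.
by apply: contraNneq x'y => ->; rewrite edge_sym.
Qed.

(** Some vertex other than [p1] is adjacent to neither [r] nor [q], so by
    connectedness there are such an [x] and a neighbour [y] of [x] which is [p1]
    or is adjacent to [r] or [q]. If [y = p], then [x] is the second child; if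
    [y] is another neighbour of [r], it starts a third branch of length 2; in all
    other cases [x] and [y] extend part of the path to 6 vertices. *)
Lemma tight_or_second_child r p q p1 q1 :
    listing r [:: 0; 0; 0; 1; 2]%N [:: r; p; q; p1; q1] ->
  tight \/ exists p2, [/\ p2 != p1, p2 != r & edge p2 p].
Proof.
move=> l5; have edge5 i j := listing_edge acycT l5 (i := i) (j := j).
have rp : edge r p by apply: (edge5 0 1).
have rq : edge r q by apply: (edge5 0 2).
have pp1 : edge p p1 by apply: (edge5 1 3).
have qq1 : edge q q1 by apply: (edge5 2 4).
have /andP[/= + _] := l5; rewrite !inE !negb_or.
case/and5P=> /and4P[r_p r_q r_p1 r_q1] /and3P[p_q _ _] _ _ _.
have [w [w_p1 wr wq]] := two_outside p1 rq.
pose N v := [|| edge v r, edge v q | v == p1].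
have Nr : N r by rewrite /N rq orbT.
have Nw : ~~ N w by rewrite /N !negb_or wr wq.
have [x [y [Nx Ny xy]]] := connected_boundary connT Nr Nw.
move: Nx; rewrite !negb_or => /and3P[xr xq x_p1].
have x_r : x != r by apply: contraNneq xq => ->.
have x_q : x != q by apply: contraNneq xr => ->; rewrite edge_sym.
have x_p : x != p by apply: contraNneq xr => ->; rewrite edge_sym.
have y_r : y != r by apply: contraNneq xr => <-.
have y_q : y != q by apply: contraNneq xq => <-.
case/or3P: Ny => [yr|yq|/eqP y_p1].
- have [y_p|y_p] := eqVneq y p; first by right; exists x; rewrite -y_p.
  left; have l2 := listing2 r rp.
  have l3 : listing r [:: 0; 0; 0]%N [:: r; p; q].
    by apply: (listing_rcons acycT l2 (p := 0%N)); rewrite //= 1?edge_sym // eq_sym p_q.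
  have l4 : listing r [:: 0; 0; 0; 0]%N [:: r; p; q; y].
    by apply: (listing_rcons acycT l3 (p := 0%N)); rewrite //= y_p y_q.
  have l5' : listing r [:: 0; 0; 0; 0; 1]%N [:: r; p; q; y; p1].
    by apply: (listing_rcons acycT l4 (p := 1%N)); rewrite //= 1?edge_sym // eq_sym r_p1.
  have l6 : listing r [:: 0; 0; 0; 0; 1; 2]%N [:: r; p; q; y; p1; q1].
    by apply: (listing_rcons acycT l5' (p := 2%N)); rewrite //= 1?edge_sym // eq_sym r_q1.
  have l7 : listing r [:: 0; 0; 0; 0; 1; 2; 3]%N [:: r; p; q; y; p1; q1; x].
    by apply: (listing_rcons acycT l6 (p := 3%N)); rewrite //= x_r.
  exact: tight_robust l7 isT (robust_rep_spider R acycT l7 erefl).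
- left; have l2 := listing2 x xy.
  have l3 : listing x [:: 0; 0; 1]%N [:: x; y; q].
    by apply: (listing_rcons acycT l2 (p := 1%N)); rewrite //= 1?edge_sym // eq_sym x_q.
  have l4 : listing x [:: 0; 0; 1; 2]%N [:: x; y; q; r].
    by apply: (listing_rcons acycT l3 (p := 2%N)); rewrite //= eq_sym y_r.
  have l5' : listing x [:: 0; 0; 1; 2; 3]%N [:: x; y; q; r; p].
    by apply: (listing_rcons acycT l4 (p := 3%N)); rewrite //= 1?edge_sym // p_q.
  have l6 : listing x [:: 0; 0; 1; 2; 3; 4]%N [:: x; y; q; r; p; p1].
    by apply: (listing_rcons acycT l5' (p := 4%N)); rewrite //= 1?edge_sym // eq_sym r_p1.
  exact: tight_robust l6 isT (robust_rep_path6 R acycT l6 erefl).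
left; rewrite {}y_p1 in xy; have l2 := listing2 x xy.
have l3 : listing x [:: 0; 0; 1]%N [:: x; p1; p].
  by apply: (listing_rcons acycT l2 (p := 1%N)); rewrite //= eq_sym x_p.
have l4 : listing x [:: 0; 0; 1; 2]%N [:: x; p1; p; r].
  by apply: (listing_rcons acycT l3 (p := 2%N)); rewrite //= r_p1.
have l5' : listing x [:: 0; 0; 1; 2; 3]%N [:: x; p1; p; r; q].
  by apply: (listing_rcons acycT l4 (p := 3%N)); rewrite //= 1?edge_sym // eq_sym p_q.
have l6 : listing x [:: 0; 0; 1; 2; 3; 4]%N [:: x; p1; p; r; q; q1].
  by apply: (listing_rcons acycT l5' (p := 4%N)); rewrite //= 1?edge_sym // eq_sym r_q1.
exact: tight_robust l6 isT (robust_rep_path6 R acycT l6 erefl).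
Qed.

(** Applying the previous lemma to both sides of the centre gives two children
    on each, that is [W(2, 0, (2, 2))], unless another of the three subtrees is
    present. *)
Lemma tight_no_dominating_edge a b : edge a b -> tight.
Proof.
move=> /centered_path5[r [p [q [p1 [q1 l5]]]]].
have [//|[p2 [p2_p1 p2_r p2p]]] := tight_or_second_child l5.
have edge5 i j := listing_edge acycT l5 (i := i) (j := j).
have /andP[/= + _] := l5; rewrite !inE !negb_or.
case/and5P=> /and4P[r_p r_q r_p1 r_q1] /and3P[p_q _ _] _ _ _.
have l2 : listing r [:: 0; 0]%N [:: r; q] by apply: listing2; apply: (edge5 0 2).
have l3 : listing r [:: 0; 0; 0]%N [:: r; q; p].
  by apply: (listing_rcons acycT l2 (p := 0%N)); rewrite //= ?(edge5 1 0) //= p_q.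
have l4 : listing r [:: 0; 0; 0; 1]%N [:: r; q; p; q1].
  by apply: (listing_rcons acycT l3 (p := 1%N)); rewrite //= ?(edge5 4 2) //= eq_sym r_q1.
have l5' : listing r [:: 0; 0; 0; 1; 2]%N [:: r; q; p; q1; p1].
  by apply: (listing_rcons acycT l4 (p := 2%N)); rewrite //= ?(edge5 3 1) //= eq_sym r_p1.
have [//|[q2 [q2_q1 q2_r q2q]]] := tight_or_second_child l5'.
have m4 : listing r [:: 0; 0; 0; 1]%N [:: r; p; q; p1].
  have /andP[uniq5 /and5P[e1 e2 e3 _ _]] := l5.
  by apply/andP; split; [apply: (take_uniq 4 uniq5) | apply/and4P].
have m5 : listing r [:: 0; 0; 0; 1; 1]%N [:: r; p; q; p1; p2].
  by apply: (listing_rcons acycT m4 (p := 1%N)); rewrite //= p2_r p2_p1.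
have m6 : listing r [:: 0; 0; 0; 1; 1; 2]%N [:: r; p; q; p1; p2; q1].
  by apply: (listing_rcons acycT m5 (p := 2%N)); rewrite //= ?(edge5 4 2) //= eq_sym r_q1.
have m7 : listing r [:: 0; 0; 0; 1; 1; 2; 2]%N [:: r; p; q; p1; p2; q1; q2].
  by apply: (listing_rcons acycT m6 (p := 2%N)); rewrite //= q2_r q2_q1.
exact: tight_robust m7 isT (robust_rep_W22 R acycT m7 erefl).
Qed.

End NoDominatingEdge.
(** If some edge [ab] dominates all vertices, [T] is a star or a double star. In
    the second case [a] and [b] have at least two leaves each: if [a] had a
    single one, an edge from [b] to a leaf would nearly dominate. *)
Lemma q_compl_le2 :
  (1 < #|T|)%N -> ~ has_near_dominating_edge T -> (q_graph R (compl T) <= 2)%N.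
Proof.
move=> T_gt1 no_missing.
suff [[k frameT]|//] : tight \/ (q_graph R (compl T) <= 2)%N.
  apply: (q_compl_le_int_diag (s := [:: k])) frameT _.
  by rewrite /= !inE eqxx orbT.
have [[a [b [ab dom]]]|nodom] :=
    pselect (exists a b, edge a b /\ forall v, edge v a || edge v b); last first.
  left; have [x [y [_ _ x_y]]] := card_gt1P T_gt1.
  have [w [p [w_x /eqP-> wx]]] : exists w p, [/\ w != x, p == x & edge w p].
    by apply: (@connected_boundary T (pred1 x) x y); rewrite //= eq_sym.
  apply: (tight_no_dominating_edge _ wx) => a b z ab; apply: contrapT => noV.
  have dom v : v != z -> edge v a || edge v b.
    by move=> v_z; apply/norP => -[va vb]; apply: noV; exists v.
  apply: no_missing; exists a, b, z; split=> //.
    by apply/negP => za; apply: nodom; exists a, b; split=> // v;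
       have [->|/dom//] := eqVneq v z; rewrite za.
  by apply/negP => zb; apply: nodom; exists a, b; split=> // v;
     have [->|/dom//] := eqVneq v z; rewrite zb orbT.
have star c e : edge c e -> (forall v, edge v c || edge v e) ->
    ~ (exists2 d, d != c & edge d e) -> (q_graph R (compl T) <= 2)%N.
  move=> ce dom' no_d; apply: (q_compl_star ce) => v v_c.
  by case/orP: (dom' v) => // ve; case: no_d; exists v.
have [[l l_b la]|no_l] := pselect (exists2 l, l != b & edge l a); last first.
  by right; apply: (star b a) => // [|v]; rewrite 1?orbC // edge_sym.
have [[d d_a db]|no_d] := pselect (exists2 d, d != a & edge d b); last first.
  by right; apply: (star a b).
have second c e l1 d1 : edge c e -> (forall v, edge v c || edge v e) ->
    edge l1 c -> l1 != e -> edge d1 e -> d1 != c ->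
    exists l2, [/\ edge l2 c, l2 != e & l2 != l1].
  move=> ce dom' l1c l1_e d1e d1_c; apply: contrapT => no_l2.
  have k2 := listing2 c ce.
  have k3 : listing c [:: 0; 0; 0]%N [:: c; e; l1].
    by apply: (listing_rcons acycT k2 (p := 0%N)); rewrite //= l1_e.
  have k4 : listing c [:: 0; 0; 0; 1]%N [:: c; e; l1; d1].
    by apply: (listing_rcons acycT k3 (p := 1%N)); rewrite //= d1_c.
  apply: no_missing; exists e, d1, l1; split; first by rewrite edge_sym.
  - by rewrite (listing_edge acycT k4 (i := 2) (j := 1)).
  - by rewrite (listing_edge acycT k4 (i := 2) (j := 3)).
  move=> v v_l1; case/orP: (dom' v) => [vc|->//].
  have [->|v_e] := eqVneq v e; first by rewrite [X in _ || X]edge_sym d1e orbT.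
  by case: no_l2; exists v.
have [l' [l'a l'_b l'_l]] := second a b l d ab dom la l_b db d_a.
have [||d' [d'b d'_a d'_d]] := second b a d l _ _ db d_a la l_b.
- by rewrite edge_sym.
- by move=> v; rewrite orbC.
by left; apply: (tight_double_star ab la l'a db d'b).
Qed.

End TwoEigenvalues.

(** * Lower bounds *)

Section LowerBounds.
Variables (R : realType) (T : sgraph) (A : 'M[R]_#|compl T|).
Hypothesis symA : @sym_matrices R (compl T) A.
Implicit Types (x y z : T) (l : R).

Let entry (B : 'M[R]_#|compl T|) x y : R :=
  B (enum_rank (x : compl T)) (enum_rank (y : compl T)).

Lemma entry_shift0 l x y : edge x y -> entry (A - l%:M) x y = 0.
Proof.
move=> xy; have x_y : x != y by apply: contraTneq xy => ->; rewrite edge_irrefl.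
have [_ /(_ (enum_rank (x : compl T)) (enum_rank (y : compl T)))] := symA.
rewrite (inj_eq enum_rank_inj) !enum_rankK => /(_ x_y).
rewrite /= /compl_edge xy andbF => /negbFE/eqP Axy.
by rewrite /entry !mxE Axy (inj_eq enum_rank_inj) (negPf x_y) subr0.
Qed.

Lemma entry_shift_neq0 l x y : x != y -> ~~ edge x y -> entry (A - l%:M) x y != 0.
Proof.
move=> x_y xy.
have [_ /(_ (enum_rank (x : compl T)) (enum_rank (y : compl T)))] := symA.
rewrite (inj_eq enum_rank_inj) !enum_rankK => /(_ x_y).
rewrite /= /compl_edge xy x_y => Axy.
by rewrite /entry !mxE (inj_eq enum_rank_inj) (negPf x_y) subr0 Axy.
Qed.

Lemma entry_mul B C x y : entry (B *m C) x y = \sum_z entry B x z * entry C z y.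
Proof.
rewrite /entry mxE (reindex (enum_rank : compl T -> 'I_#|compl T|)) //=.
by apply: onW_bij; apply: enum_rank_bij.
Qed.

(** The lower bounds rest on products of which the zero pattern leaves a single
    term. *)
Lemma entry_mul1 B C x y z :
    (forall v, v != z -> entry B x v = 0 \/ entry C v y = 0) ->
  entry (B *m C) x y = entry B x z * entry C z y.
Proof.
move=> zero; rewrite entry_mul (bigD1 z) //= big1 ?addr0 // => v /zero.
by case=> ->; rewrite ?mul0r ?mulr0.
Qed.

Lemma q_mx_gt1 x y : x != y -> ~~ edge x y -> (1 < q_mx A)%N.
Proof.
move=> x_y xy; rewrite ltnNge; apply/negP => /spectrum_le_q_mx[s size_s eigA].
have := sym_annihilated symA.1 eigA; case: s size_s {eigA} => [|l []] //= _.
move/(congr1 (fun B => entry B x y)); rewrite mulmx1 {2}/entry mxE.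
by apply/eqP; apply: entry_shift_neq0.
Qed.

Lemma q_mx_gt2 (a b w : T) : misses_one a b w -> (2 < q_mx A)%N.
Proof.
move=> [ab wa wb dom]; rewrite ltnNge; apply/negP => /spectrum_le_q_mx[s size_s eigA].
have := sym_annihilated symA.1 eigA; case: s size_s {eigA} => [|l [|m []]] //= _.
move/(congr1 (fun B => entry B a b)); rewrite mulmx1 {2}/entry mxE.
rewrite (@entry_mul1 _ _ a b w) => [|v /dom/orP[va|vb]]; last 2 first.
- by left; apply: entry_shift0; rewrite edge_sym.
- by right; apply: entry_shift0.
have w_a : w != a by apply: contraNneq wb => ->.
have w_b : w != b by apply: contraNneq wa => ->; rewrite edge_sym.
apply/eqP; rewrite mulf_neq0 ?entry_shift_neq0 // 1?eq_sym // edge_sym.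
by [].
Qed.

Lemma q_mx_gt3 (v0 v1 v2 v3 : T) :
    uniq [:: v0; v1; v2; v3] -> (forall v, v \in [:: v0; v1; v2; v3]) ->
    [/\ edge v0 v1, edge v1 v2 & edge v2 v3] ->
    [/\ ~~ edge v0 v2, ~~ edge v0 v3 & ~~ edge v1 v3] ->
  (3 < q_mx A)%N.
Proof.
move=> uniq4 all4 [e01 e12 e23] [e02 e03 e13].
rewrite ltnNge; apply/negP => /spectrum_le_q_mx[s size_s eigA].
have := sym_annihilated symA.1 eigA; case: s size_s {eigA} => [|l [|m [|n []]]] //= _.
move/(congr1 (fun B => entry B v2 v1)); rewrite mulmx1 {2}/entry mxE.
have e10 : edge v1 v0 by rewrite edge_sym.
have e21 : edge v2 v1 by rewrite edge_sym.
have case4 (P : T -> Prop) : P v0 -> P v1 -> P v2 -> P v3 -> forall v, P v.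
  move=> ? ? ? ? v; have := all4 v; rewrite !inE.
  by case/or4P=> /eqP->.
have mid22 : entry ((A - m%:M) *m (A - n%:M)) v2 v1 = 0.
  rewrite entry_mul big1 // => v _; move: v; apply: case4.
  - by rewrite (entry_shift0 n e01) mulr0.
  - by rewrite (entry_shift0 m e21) mul0r.
  - by rewrite (entry_shift0 n e21) mulr0.
  - by rewrite (entry_shift0 m e23) mul0r.
rewrite (@entry_mul1 _ _ v2 v1 v0); last first.
  apply: case4 => [|_|_|_]; first by rewrite eqxx.
  - by left; apply: entry_shift0.
  - by right.
  - by left; apply: entry_shift0.
rewrite (@entry_mul1 _ _ v0 v1 v3); last first.
  apply: case4 => [_|_|_|]; last by rewrite eqxx.
  - by right; apply: entry_shift0.
  - by left; apply: entry_shift0.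
  - by right; apply: entry_shift0.
move: uniq4; rewrite /= !inE !negb_or => /and4P[/and3P[_ v02 v03] /andP[_ v13] _ _].
by apply/eqP; rewrite !mulf_neq0 ?entry_shift_neq0 // 1?eq_sym // edge_sym.
Qed.

End LowerBounds.

(** * The theorem *)

Local Close Scope ring_scope.

Theorem theorem3p2 (R : realType) (T : sgraph) (hT : tree T)
    (hcard : (3 <= #|T|)%N) :
  let exceptional :=
    (exists k m : nat, [/\ (k = 2 \/ k = 3), (1 <= m)%N
                         & isomorphic T (S_graph k m 1)])
    \/ (exists l d : nat, (1 <= d)%N /\
                          isomorphic T (W_graph 2 l [tuple 1%N; d])) in
  [/\ isomorphic T (path_graph 4) -> q_graph R (compl T) = 4%N,
      ~ isomorphic T (path_graph 4) -> exceptional ->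
        q_graph R (compl T) = 3%N
    & ~ isomorphic T (path_graph 4) -> ~ exceptional ->
        q_graph R (compl T) = 2%N].
Proof.
have [_ connT acycT] := hT.
split=> [isoP4|notP4 exc|notP4 notexc]; apply/eqP; rewrite eqn_leq.
- have [cardT [v0 [v1 [v2 [v3 [uniq4 all4 e4 n4]]]]]] := path4_order isoP4.
  rewrite (leq_trans (q_graph_le_card R _)) ?cardT //=.
  by apply: q_graph_ge => A symA; apply: q_mx_gt3 uniq4 all4 e4 n4.
- have missT := exceptional_near_dominating exc; rewrite q_compl_le3 //=.
  have [a [b [w missT']]] := missT.
  by apply: q_graph_ge => A symA; apply: q_mx_gt2 missT'.
have [x [y [x_y xy]]] := nonadjacent_pair acycT hcard.
rewrite q_compl_le2 ?(ltnW hcard) //=.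
  by apply: q_graph_ge => A symA; apply: q_mx_gt1 x_y xy.
by move=> /(near_dominating_exceptional connT acycT).
Qed.
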